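(* Let $H=(V,E)$ be a hypergraph with $n=|V|$ vertices (none of degree $0$), $m=|E|$ hyperedges, maximum vertex degree $\Delta$, rank $d=\max_{e\in E}|e|$, and $\kappa=\sum_{v\in V}\deg(v)$. The randomized local max algorithm for (cardinality) hypergraph matching described in the context can be executed on a CREW PRAM so that, with high probability, it runs in $O((\log\Delta+\log d)\log m)$ time and performs $O((\kappa+n)\log m)$ total work, outputting a maximal matching of $H$.
   Context: A hypergraph $H=(V,E)$ has vertex set $V$ and a set $E$ of hyperedges, each a subset of $V$; $\deg(v)$ is the number of hyperedges containing $v$. A matching is a set of pairwise vertex-disjoint hyperedges; it is maximal if no hyperedge can be added. The CREW PRAM is a synchronous shared-memory machine with unit-time operations allowing concurrent reads but only exclusive writes; work is the total number of operations performed. The randomized local max algorithm: all vertices and hyperedges start active and $M=\emptyset$. Each round: every active hyperedge receives a fresh independent uniformly random weight; every active vertex selects the active hyperedge containing it of maximum weight; every active hyperedge selected by all of its vertices is added to $M$; all vertices of newly matched hyperedges and all hyperedges containing such vertices are marked inactive. Rounds repeat until no hyperedge is active. ''With high probability'' refers to the randomness of the weights. *)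

(* Defs.v *)
From HB Require Import structures.
From mathcomp Require Import all_boot all_order all_algebra.
From mathcomp Require Import all_classical all_reals all_analysis.

Set Implicit Arguments.
Unset Strict Implicit.
Unset Printing Implicit Defensive.

Import Order.TTheory GRing.Theory Num.Theory.

Local Open Scope nat_scope.

(* A hypergraph is a finite type V of vertices with a set E : {set {set V}} of
   hyperedges. *)

Definition deg (V : finType) (E : {set {set V}}) (v : V) : nat :=
  #|[set e in E | v \in e]|.

Definition max_deg (V : finType) (E : {set {set V}}) : nat :=
  \max_(v : V) deg E v.

Definition rank (V : finType) (E : {set {set V}}) : nat := \max_(e in E) #|e|.

Definition kappa (V : finType) (E : {set {set V}}) : nat :=
  \sum_(v : V) deg E v.

Definition is_matching (V : finType) (E M : {set {set V}}) : bool :=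
  (M \subset E) && finset.trivIset M.

Definition is_maximal_matching (V : finType) (E M : {set {set V}}) : bool :=
  is_matching E M && [forall e in E :\: M, ~~ is_matching E (e |: M)].

(* lg k = 1 + floor(log2 k), a logarithm that is at least 1, as is implicit in
   an O-bound such as O((log Delta + log d) log m): for Delta = d = 1 or m = 1
   the plain logarithms would give the bound 0. *)
Definition lg (k : nat) : nat := (trunc_log 2 k).+1.

Section LocalMax.
Variables (R : realType) (V : finType) (E : {set {set V}}).

Record lm_state := LMState {
  act_vertices : {set V};
  act_edges : {set {set V}};
  matched : {set {set V}} }.

(* If several active hyperedges containing v have the maximum weight, one of
   them is picked; ties have probability 0 for independent uniform weights. *)
Definition selection (S : lm_state) (w : {set V} -> R) (v : V) :
    option {set V} :=
  if v \in act_vertices S then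
    [pick e in act_edges S | (v \in e) &&
       [forall e' in act_edges S, (v \in e') ==> (w e' <= w e)%R]]
  else None.

Definition lm_round (w : {set V} -> R) (S : lm_state) : lm_state :=
  let new := [set e in act_edges S |
                [forall v in e, selection S w v == Some e]] in
  LMState (act_vertices S :\: finset.cover new)
          [set e in act_edges S | [disjoint e & finset.cover new]]
          (matched S :|: new).

(* w r e is the weight received by e in round r. *)
Fixpoint lm_run (w : nat -> {set V} -> R) (r : nat) : lm_state :=
  if r is r'.+1 then lm_round (w r') (lm_run w r')
  else LMState finset.setT E finset.set0.

(* A round without active hyperedges does not change the matching, so M is
   unique. *)
Definition lm_output (w : nat -> {set V} -> R) (M : {set {set V}}) : Prop :=
  exists r, act_edges (lm_run w r) = finset.set0 /\ matched (lm_run w r) = M.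

End LocalMax.

(* The CREW PRAM, in the work-time presentation.  The shared memory consists of
   arrays of integer cells and arrays of weight cells, both indexed by nat.
   Weights are real numbers; they can only be drawn, copied and compared.
   Processors are numbered from 0 and run the same program.  As in the
   Fortune-Wyllie P-RAM the integer operations are additive: there is no
   unit-time multiplication. *)

Inductive binop := Add | Sub | Eq | Lt.

Inductive expr :=
| Const of nat
| Pid                                     (* number of the processor *)
| Read of nat & expr                      (* Read a k: integer cell a[k] *)
| Bin of binop & expr & expr
| Half of expr
| LtW of nat & expr & nat & expr.         (* weight cells: a[k] < b[l] *)

Inductive instr :=
| Store of nat & expr & expr              (* integer cells: a[k] := x *)
| Copy of nat & expr & nat & expr         (* weight cells: a[k] := b[l] *)
| Draw of nat & expr.                     (* weight cell: a[k] := random *)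

(* Par p g i: for all processors below p in parallel, if g <> 0 then i. *)
Inductive cmd :=
| Skip
| Seq of cmd & cmd
| Par of expr & expr & instr
| While of expr & cmd.

Record pram_state (R : Type) := PramState {
  ints : nat -> nat -> nat;
  weights : nat -> nat -> R;
  draws : nat }.                          (* Draw instructions executed *)

(* The size of an expression or instruction is the number of unit-time
   operations needed to execute it on one processor. *)
Fixpoint expr_size (x : expr) : nat :=
  match x with
  | Const _ | Pid => 1
  | Read _ k => (expr_size k).+1
  | Bin _ x y => (expr_size x + expr_size y).+1
  | Half x => (expr_size x).+1
  | LtW _ k _ l => (expr_size k + expr_size l).+1
  end.

Definition instr_size (i : instr) : nat :=
  match i with
  | Store _ k x => (expr_size k + expr_size x).+1
  | Copy _ k _ l => (expr_size k + expr_size l).+1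
  | Draw _ k => (expr_size k).+1
  end.

Section Semantics.
Variable R : realType.
Implicit Type s : pram_state R.

Definition binop_eval (o : binop) (x y : nat) : nat :=
  match o with
  | Add => x + y | Sub => x - y | Eq => x == y | Lt => x < y
  end.

Fixpoint eval s (pid : nat) (x : expr) : nat :=
  match x with
  | Const k => k
  | Pid => pid
  | Read a k => ints s a (eval s pid k)
  | Bin o x y => binop_eval o (eval s pid x) (eval s pid y)
  | Half x => (eval s pid x)./2
  | LtW a k b l =>
      (weights s a (eval s pid k) < weights s b (eval s pid l))%R
  end.

Definition upd (A : Type) (f : nat -> nat -> A) (a k : nat) (x : A) :
    nat -> nat -> A :=
  fun a' k' => if (a' == a) && (k' == k) then x else f a' k'.

Definition address s (i : instr) (pid : nat) : nat :=
  match i with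
  | Store _ k _ | Copy _ k _ _ | Draw _ k => eval s pid k
  end.

(* All processors read the memory s before any of them writes; s1 accumulates
   the writes. *)
Definition write (rnd : nat -> nat -> R) s (i : instr) s1 (pid : nat) :
    pram_state R :=
  let k := address s i pid in
  match i with
  | Store a _ x =>
      PramState (upd (ints s1) a k (eval s pid x)) (weights s1) (draws s1)
  | Copy a _ b l =>
      PramState (ints s1) (upd (weights s1) a k (weights s b (eval s pid l)))
                (draws s1)
  | Draw a _ =>
      PramState (ints s1) (upd (weights s1) a k (rnd (draws s) pid)) (draws s1)
  end.

Definition enabled s (p : nat) (g : expr) : seq nat :=
  [seq pid <- iota 0 p | eval s pid g != 0].

Definition par_step (rnd : nat -> nat -> R) s (p : nat) (g : expr)
    (i : instr) : pram_state R :=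
  let s1 := foldl (write rnd s i) s (enabled s p g) in
  if i is Draw _ _ then PramState (ints s1) (weights s1) (draws s1).+1 else s1.

(* exec rnd c s s' t w: started in s, the program c halts in s' after time t
   and work w.  rnd k j is the random number that processor j obtains when
   the Draw instruction is executed for the (k+1)-st time.  An instruction in
   which two processors write to the same cell has no execution (exclusive
   write).  A processor whose guard fails is still charged for the complete
   instruction. *)
Inductive exec (rnd : nat -> nat -> R) :
    cmd -> pram_state R -> pram_state R -> nat -> nat -> Prop :=
| ExecSkip s : exec rnd Skip s s 0 0
| ExecSeq c1 c2 s1 s2 s3 t1 t2 w1 w2 :
    exec rnd c1 s1 s2 t1 w1 -> exec rnd c2 s2 s3 t2 w2 ->
    exec rnd (Seq c1 c2) s1 s3 (t1 + t2) (w1 + w2)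
| ExecPar np g i s :
    let p := eval s 0 np in
    let cost := expr_size g + instr_size i in
    uniq [seq address s i pid | pid <- enabled s p g] ->
    exec rnd (Par np g i) s (par_step rnd s p g i)
         (expr_size np + cost) (expr_size np + p * cost)
| ExecWhileFalse g c s :
    eval s 0 g = 0 ->
    exec rnd (While g c) s s (expr_size g).+1 (expr_size g).+1
| ExecWhileTrue g c s1 s2 s3 t1 t2 w1 w2 :
    eval s1 0 g != 0 ->
    exec rnd c s1 s2 t1 w1 -> exec rnd (While g c) s2 s3 t2 w2 ->
    exec rnd (While g c) s1 s3
         ((expr_size g).+1 + t1 + t2) ((expr_size g).+1 + w1 + w2).

End Semantics.

(* Input: H is given by its incidence lists in both directions, stored as
   adjacency arrays.  The lists vs and es number the vertices and hyperedges;
   the numberings and the order of each incidence list are arbitrary. *)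

Definition represents (V : finType) (E : {set {set V}}) (vs : seq V)
    (es : seq {set V}) (vrows erows : seq (seq nat)) : Prop :=
  [/\ perm_eq vs (enum V) /\ perm_eq es (enum E),
      size vrows = #|V|, size erows = #|E|,
      forall v : V, perm_eq (nth [::] vrows (index v vs))
                            [seq index e es | e : {set V} <- enum E & v \in e]
    & forall e : {set V}, e \in E ->
        perm_eq (nth [::] erows (index e es)) [seq index v vs | v <- enum e]].

Definition offsets (rows : seq (seq nat)) : seq nat :=
  0 :: scanl addn 0 (shape rows).

Definition input_ints (n m k : nat) (vrows erows : seq (seq nat)) :
    nat -> nat -> nat :=
  fun a => nth 0 (nth [::] [:: [:: n; m; k];
                               offsets vrows; flatten vrows;
                               offsets erows; flatten erows] a).

Definition input_state (R : realType) (V : finType) (E : {set {set V}})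
    (vrows erows : seq (seq nat)) : pram_state R :=
  PramState (input_ints #|V| #|E| (kappa E) vrows erows) (fun _ _ => 0%R) 0.

Definition output_array : nat := 5.

Definition outputs (R : realType) (V : finType) (E : {set {set V}})
    (es : seq {set V}) (s : pram_state R) (M : {set {set V}}) : Prop :=
  forall e, e \in E -> ints s output_array (index e es) = (e \in M).

Local Open Scope classical_set_scope.
Local Open Scope ring_scope.

Definition mutually_independent (R : realType) (d : measure_display)
    (T : measurableType d) (P : probability T R) (I : eqType)
    (X : I -> {RV P >-> R}) : Prop :=
  forall (J : seq I) (B : I -> set R), uniq J -> (forall i, measurable (B i)) ->
    P (\big[setI/setT]_(i <- J) (X i @^-1` B i)) =
    (\prod_(i <- J) P (X i @^-1` B i))%E.

Definition uniform01 (R : realType) (d : measure_display)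
    (T : measurableType d) (P : probability T R) (X : {RV P >-> R}) : Prop :=
  forall B : set R, measurable B ->
    distribution P X B = uniform_prob (@ltr01 R) B.

(* Main.v *)
(* Local max is a Luby-type independent set algorithm on the line graph. Let D(e) be the number
   of active hyperedges meeting the active hyperedge e, including e. In one round the expected
   value of the potential, the sum of all D(e), drops by a factor of 2. It is at most m^2 at
   the start, so after (c + 3) lg m rounds no hyperedge is active, except with probability less
   than (m + 1)^-c. The weights are rounded down to multiples of 1/N for a large N: then all
   probabilities are proportions of finite weight functions, ties become a part of the failure
   event, and a run without ties depends on the rounded weights only.

   On the PRAM, selecting hyperedges at the vertices and deciding whether all (or some) vertices
   of a hyperedge have a property are three segmented maximum computations on the adjacency
   arrays. A tree scan truncated at the height log (max Delta d) does each of them with time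
   O(log Delta + log d) and linear work. Testing for active hyperedges takes time O(log m), and
   is done once in lg m rounds. *)

Require Import Defs.
From HB Require Import structures.
From mathcomp Require Import all_boot all_order all_algebra.
From mathcomp Require Import all_classical all_reals all_analysis.
From mathcomp Require Import perm zify ring.
Import Order.TTheory GRing.Theory Num.Theory.
Set Implicit Arguments.
Unset Strict Implicit.
Unset Printing Implicit Defensive.
Local Open Scope nat_scope.
Local Notation eval := Defs.eval.

(** * Time and work of PRAM programs *)

(** Costs are not computed instruction by instruction. A straight-line command, a scan or a
    preprocessing loop is charged its [cmd_size] times a common budget, proportional to the scan
    height for time and to the tree size for work. Such bounds add up along [Seq], so the constants
    of the theorem are built from sizes of fixed programs. The program is chosen before [c], so it
    cannot count [c + 3] batches of rounds. It repeats batches of [lg m] rounds until a test finds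
    no active hyperedge, and [c] enters only through the number of batches needed on the good event.
    The test and the preprocessing use scans of full height, about log kappa. This fits the time
    bound because kappa is at most m d. The good event is a finite union of boxes of weights, so its
    measurability is immediate and its probability is a count; nothing is claimed about the set of
    all outcomes on which the program succeeds. Ties of rounded weights and surviving hyperedges
    each get half of the allowed failure probability, the former by the fineness of the rounding,
    the latter by the Markov inequality for the potential. *)

Fixpoint cmd_size (c : cmd) : nat :=
  match c with
  | Skip => 0
  | Seq c1 c2 => cmd_size c1 + cmd_size c2
  | Par np g i => expr_size np + expr_size g + instr_size i
  | While g c => (expr_size g).+1 + cmd_size c
  end.

Section Logic.
Variables (R : realType) (rnd : nat -> nat -> R).
Implicit Types (s : pram_state R) (Q : pram_state R -> Prop).

Definition runs (c : cmd) s (t w : nat) Q : Prop :=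
  exists s' t' w', [/\ exec rnd c s s' t' w', t' <= t, w' <= w & Q s'].

Lemma runs_weaken c s t w t' w' Q Q' :
  runs c s t w Q -> t <= t' -> w <= w' -> (forall s', Q s' -> Q' s') ->
  runs c s t' w' Q'.
Proof.
move=> [s' [t1 [w1 [e1 ht hw q]]]] tt' ww' QQ'.
by exists s', t1, w1; split; rewrite ?(leq_trans ht) ?(leq_trans hw) //; apply: QQ'.
Qed.

Lemma runs_seq c1 c2 s t1 t2 w1 w2 Q1 Q :
  runs c1 s t1 w1 Q1 -> (forall s1, Q1 s1 -> runs c2 s1 t2 w2 Q) ->
  runs (Seq c1 c2) s (t1 + t2) (w1 + w2) Q.
Proof.
move=> [s1 [a1 [b1 [e1 ha1 hb1 q1]]]] /(_ _ q1) [s2 [a2 [b2 [e2 ha2 hb2 q2]]]].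
exists s2, (a1 + a2), (b1 + b2); split=> //; [exact: ExecSeq e1 e2|lia|lia].
Qed.

Definition store_state s a (row : nat -> nat) : pram_state R :=
  PramState (fun a' => if a' == a then row else ints s a') (weights s) (draws s).

Lemma ints_store s a row a' :
  ints (store_state s a row) a' = if a' == a then row else ints s a'.
Proof. by []. Qed.

Lemma foldl_store s a k x l s0 :
  uniq [seq eval s pid k | pid <- l] ->
  let s1 := foldl (write rnd s (Store a k x)) s0 l in
  [/\ weights s1 = weights s0, draws s1 = draws s0,
      forall pid, pid \in l -> ints s1 a (eval s pid k) = eval s pid x
    & forall a' k', (a' != a) || (k' \notin [seq eval s pid k | pid <- l]) ->
        ints s1 a' k' = ints s0 a' k'].
Proof.
elim: l s0 => [|p l IH] s0 //= /andP[pl ul].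
have [h1 h2 h3 h4] := IH (write rnd s (Store a k x) s0 p) ul.
split=> //.
- move=> pid; rewrite inE => /predU1P[->|]; last exact: h3.
  by rewrite h4 ?pl ?orbT //= /upd !eqxx.
- move=> a' k'; rewrite inE negb_or => h.
  have := h4 a' k'; rewrite /= /upd => ->; last by case/orP: h => [->|/andP[_ ->]]; rewrite ?orbT.
  by case: ifP => // /andP[/eqP ea /eqP ek]; move: h; rewrite ea ek !eqxx.
Qed.

(** Injectivity of the address on the enabled processors is the exclusive-write condition. The
    factor [p.+1] in the work also pays for [np], which is evaluated only once. *)
Lemma runs_store_gen np g a k x s (row : nat -> nat) Q :
  let p := eval s 0 np in
  (forall i j, i < p -> j < p -> eval s i g != 0 -> eval s j g != 0 ->
     eval s i k = eval s j k -> i = j) ->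
  (forall i, i < p -> eval s i g != 0 -> row (eval s i k) = eval s i x) ->
  (forall k', (forall i, i < p -> eval s i g != 0 -> eval s i k != k') ->
     row k' = ints s a k') ->
  Q (store_state s a row) ->
  runs (Par np g (Store a k x)) s (cmd_size (Par np g (Store a k x)))
    (cmd_size (Par np g (Store a k x)) * p.+1) Q.
Proof.
move=> p inj r1 r2 q.
have memE i : (i \in enabled s p g) = (i < p) && (eval s i g != 0).
  by rewrite /enabled mem_filter mem_iota /= add0n andbC.
have un : uniq [seq eval s i k | i <- enabled s p g].
  rewrite map_inj_in_uniq; first by rewrite filter_uniq ?iota_uniq.
  by move=> i j; rewrite !memE => /andP[? ?] /andP[? ?]; apply: inj.
exists (store_state s a row), (expr_size np + (expr_size g + instr_size (Store a k x))),
  (expr_size np + p * (expr_size g + instr_size (Store a k x))).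
have E : store_state s a row = par_step rnd s p g (Store a k x).
  rewrite /par_step.
  have [] := foldl_store a x s un.
  set s1 := foldl _ _ _; case: s1 => i1 w1 d1 /= -> -> h3 h4.
  rewrite /store_state; congr PramState; apply: funext => a'; apply: funext => k'.
  case: eqP => [->|/eqP ne]; last by rewrite h4 ?ne.
  have [/mapP[i im ->]|nin] := boolP (k' \in [seq eval s i k | i <- enabled s p g]).
    by rewrite h3 // r1 //; move: im; rewrite memE => /andP[].
  rewrite h4 ?nin ?orbT // r2 // => i ip ig; apply: contra nin => /eqP <-.
  by apply: map_f; rewrite memE ip.
split=> //; [rewrite E; exact: ExecPar|rewrite /=; lia|rewrite /=; nia].
Qed.

(* Processor [i] writes to cell [b + i]; registers are the case of one processor and [b = 0]. *)
Definition shift_row s (a b p : nat) (g val : nat -> nat) : nat -> nat :=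
  fun k => if (b <= k) && (k < b + p) && (g (k - b) != 0) then val (k - b)
           else ints s a k.

Lemma runs_store np g a k x s b Q :
  let p := eval s 0 np in
  (forall i, i < p -> eval s i k = b + i) ->
  Q (store_state s a
       (shift_row s a b p (fun i => eval s i g) (fun i => eval s i x))) ->
  runs (Par np g (Store a k x)) s (cmd_size (Par np g (Store a k x)))
    (cmd_size (Par np g (Store a k x)) * p.+1) Q.
Proof.
move=> p ek q; apply: runs_store_gen q.
- by move=> i j ip jp _ _; rewrite !ek // => /addnI.
- move=> i ip ig; rewrite /shift_row ek // addKn ig.
  by have -> : (b <= b + i) && (b + i < b + p) by lia.
- move=> k' h; rewrite /shift_row; case: ifP => // /andP[/andP[h1 h2] h3].
  have ip : k' - b < p by lia.
  by have := h _ ip h3; rewrite ek // subnKC // eqxx.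
Qed.

Definition draw_state s (p : nat) : pram_state R :=
  PramState (ints s)
    (fun a k => if (a == 0) && (k < p) then rnd (draws s) k else weights s a k)
    (draws s).+1.

Lemma runs_draw np s Q :
  let p := eval s 0 np in
  Q (draw_state s p) ->
  runs (Par np (Const 1) (Draw 0 Pid)) s (cmd_size (Par np (Const 1) (Draw 0 Pid)))
    (cmd_size (Par np (Const 1) (Draw 0 Pid)) * p.+1) Q.
Proof.
move=> p q.
exists (draw_state s p), (expr_size np + 3), (expr_size np + p * 3).
have enE : enabled s p (Const 1) = iota 0 p by rewrite /enabled filter_predT.
have E : draw_state s p = par_step rnd s p (Const 1) (Draw 0 Pid).
  rewrite /par_step enE.
  set s1 := foldl _ _ _.
  have : [/\ ints s1 = ints s, draws s1 = draws s & forall a k,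
     weights s1 a k = if (a == 0) && (k < p) then rnd (draws s) k else weights s a k].
    rewrite {}/s1; elim: (p) => [|p' IH].
      by split=> // a k; rewrite ltn0 andbF.
    rewrite -addn1 iotaD foldl_cat add0n.
    set s1 := foldl _ s (iota 0 p') in IH *.
    case: IH => h1 h2 h3; rewrite /=; split=> // a k; rewrite /upd h3 addn1 ltnS.
    by case: (a == 0) => //=; case: ltngtP => [| |->].
  case: s1 => i1 w1 d1 /= [-> -> h]; congr PramState.
  by apply: funext => a; apply: funext => k; rewrite h.
split=> //; [|rewrite /=; lia|rewrite /=; nia].
by rewrite E; apply: ExecPar; rewrite enE map_inj_uniq ?iota_uniq //; move=> ? ?.
Qed.

(** [l] counts the iterations still to come. The work [wb] may depend on it, since the sweeps of a
    scan have bodies of geometrically varying work. *)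
Lemma runs_for (I : nat -> pram_state R -> Prop) g c tb (wb : nat -> nat) :
  (forall s, I 0 s -> eval s 0 g = 0) ->
  (forall l s, I l.+1 s -> eval s 0 g != 0 /\ runs c s tb (wb l) (I l)) ->
  forall l s, I l s ->
  runs (While g c) s ((expr_size g).+1 * l.+1 + tb * l)
    ((expr_size g).+1 * l.+1 + \sum_(i < l) wb i) (I 0).
Proof.
move=> h0 hS; elim=> [|l IH] s Is.
  exists s, (expr_size g).+1, (expr_size g).+1; rewrite muln0 muln1 big_ord0 !addn0.
  split; [exact: ExecWhileFalse (h0 _ Is)| | |]; rewrite ?leqnn //.
have [gn [s1 [t1 [w1 [e1 ht hw I1]]]]] := hS _ _ Is.
have [s2 [t2 [w2 [e2 ht2 hw2 I2]]]] := IH _ I1.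
exists s2, ((expr_size g).+1 + t1 + t2), ((expr_size g).+1 + w1 + w2).
split=> //; first exact: ExecWhileTrue e1 e2.
  by move: ht2; rewrite !mulnS; lia.
rewrite big_ord_recr /=; move: hw2; set S := \sum_(i < l) _; rewrite !mulnS => hw2. lia.
Qed.

End Logic.

Arguments runs_store {R rnd np g a k x s} b {Q}.

(** * Segmented maximum *)

(** Connectives for operands with values 0 and 1, made from addition and comparison. *)
Definition And a b := Bin Lt (Const 1) (Bin Add a b).
Definition Or a b := Bin Lt (Const 0) (Bin Add a b).
Definition Double a := Bin Add a a.
Definition Incr a := Bin Add a (Const 1).
Definition Reg a := Read a (Const 0).
Definition SetReg a x := Par (Const 1) (Const 1) (Store a (Const 0) x).

Local Notation tree := 6.
Local Notation rN := 16.
Local Notation rT := 17.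
Local Notation rM := 18.

(* A truncated Brent-Kung scan: for every position [x] it computes a position of largest
   key in the part of the segment of [x] that starts at [x], where segments are the maximal
   runs of equal values in [own]. Node [i] of the complete binary tree with leaves [N, 2N)
   has children [2i] and [2i + 1]. Sweeping only between the leaves and the level of width
   [T = N / 2^L] takes time O(L) and work O(N), and suffices for segments of length at
   most [2^L]. *)
Definition scan (own : nat) (lt : expr -> expr -> expr) : cmd :=
  let beats y z := And (Bin Eq (Read own y) (Read own z)) (lt y z) in
  let node := Bin Add (Reg rM) Pid in
  let right := Half (Incr node) in
  Seq (Par (Reg rN) (Const 1) (Store tree (Bin Add (Reg rN) Pid) Pid))
  (Seq (SetReg rM (Reg rN))
  (Seq (While (Bin Lt (Reg rT) (Reg rM))
         (Seq (SetReg rM (Half (Reg rM)))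
              (Par (Reg rM) (Const 1)
                 (Store tree node
                    (Read tree (Bin Add (Double node)
                       (beats (Read tree (Double node))
                              (Read tree (Incr (Double node))))))))))
       (While (Bin Lt (Reg rM) (Reg rN))
         (Seq (SetReg rM (Double (Reg rM)))
              (Par (Reg rM)
                 (Or (Bin Eq (Double (Half node)) node)
                     (And (Bin Lt (Incr node) (Double (Reg rM)))
                          (beats (Read tree node) (Read tree right))))
                 (Store tree node (Read tree right))))))).

Section SegmentMax.
Variables (own : nat -> nat) (ltk : rel nat) (N : nat).
Hypothesis lt_irr : irreflexive ltk.
Hypothesis lt_tr : transitive ltk.
Hypothesis lt_neg : forall x y z, ltk y x -> ltk y z || ltk z x.
Hypothesis contig : forall x y z,
  x <= y <= z -> z < N -> own x = own z -> own y = own z.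

Definition seg_max (p len z : nat) : Prop :=
  [/\ p <= z, z < p + len, own z = own p
    & forall x, p <= x < p + len -> own x = own p -> ~~ ltk z x].

Lemma seg_max1 p : seg_max p 1 p.
Proof.
split=> //; first by rewrite addn1.
move=> x hx _; have -> : x = p by lia.
by rewrite lt_irr.
Qed.

Definition seg_pick (y z : nat) : nat :=
  if (own y == own z) && ltk y z then z else y.

(** If the owners of [y] and [z] differ, then by contiguity the segment of [p] ends inside the first
    block and [y] stays the answer. Otherwise both blocks contribute to one segment; maximality
    passes to the winner by transitivity, or by negative transitivity when [y] is kept. *)
Lemma seg_max_pick p l1 l2 y z : p + l1 + l2 <= N ->
  seg_max p l1 y -> seg_max (p + l1) l2 z -> seg_max p (l1 + l2) (seg_pick y z).
Proof.
move=> hN [y1 y2 y3 y4] [z1 z2 z3 z4]; rewrite /seg_pick.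
have [/= oyz|/= oyz] := eqVneq (own y) (own z); last first.
  split=> //; first lia.
  move=> x hx ox; case: (ltnP x (p + l1)) => xl; first by apply: y4 => //; lia.
  exfalso; case/eqP: oyz; rewrite y3 z3 -ox.
  by symmetry; rewrite (contig (x := p) (z := x)) //; lia.
have op : own p = own (p + l1) by rewrite -y3 oyz.
case: ifP => lyz.
  split; [lia|lia|by rewrite -oyz|].
  move=> x hx ox; case: (ltnP x (p + l1)) => xl; last first.
    by apply: z4; [lia|rewrite -op].
  have : ~~ ltk y x by apply: y4 => //; lia.
  by apply: contra; apply: lt_tr.
split=> //; first lia.
move=> x hx ox; case: (ltnP x (p + l1)) => xl; first by apply: y4 => //; lia.
apply/negP => /(@lt_neg _ _ z); rewrite lyz /=; apply/negP.
by apply: z4; [lia|rewrite -op].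
Qed.
End SegmentMax.

Section Scan.
Variables (R : realType) (rnd : nat -> nat -> R).
Implicit Types (s : pram_state R) (Q : pram_state R -> Prop).

Lemma eval_and s pid a b (x y : bool) :
  eval s pid a = x -> eval s pid b = y -> eval s pid (And a b) = x && y.
Proof. by rewrite /= => -> ->; case: x; case: y. Qed.

Lemma eval_or s pid a b (x y : bool) :
  eval s pid a = x -> eval s pid b = y -> eval s pid (Or a b) = x || y.
Proof. by rewrite /= => -> ->; case: x; case: y. Qed.

Definition same s s' : Prop :=
  [/\ weights s' = weights s, draws s' = draws s
    & forall a, a != tree -> a != rM -> ints s' a = ints s a].

Lemma same_store s s' a row : (a == tree) || (a == rM) ->
  same s s' -> same s (store_state s' a row).
Proof.
move=> ha [h1 h2 h3]; split=> //= a' n1 n2.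
case: eqP => [e|_]; last exact: h3.
by move: ha; rewrite -e (negbTE n1) (negbTE n2).
Qed.

Lemma runs_setreg a x s Q :
  Q (store_state s a (fun k => if k == 0 then eval s 0 x else ints s a k)) ->
  runs rnd (SetReg a x) s (cmd_size (SetReg a x)) (cmd_size (SetReg a x) * 2) Q.
Proof.
move=> q; apply: (runs_store 0) => [i|]; first by rewrite /=; lia.
move: q; set s1 := store_state _ _ _; set s2 := store_state _ _ _.
suff -> : s1 = s2 by [].
congr (store_state s a); apply: funext => k; rewrite /shift_row subn0 /=.
by case: k => //= k; rewrite andbF.
Qed.

Lemma runs_scan s own lt (ltk : rel nat) h L Q :
  let N := 2 ^ h in let c := cmd_size (scan own lt) in
  own != tree -> own != rM -> L <= h ->
  ints s rN 0 = N -> ints s rT 0 = 2 ^ (h - L) ->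
  irreflexive ltk -> transitive ltk ->
  (forall x y z, ltk y x -> ltk y z || ltk z x) ->
  (forall x y z, x <= y <= z -> z < N -> ints s own x = ints s own z ->
     ints s own y = ints s own z) ->
  (forall s' pid y z, same s s' ->
     eval s' pid (lt y z) = ltk (eval s' pid y) (eval s' pid z)) ->
  (forall s', same s s' ->
     (forall p, p < N -> let z := ints s' tree (N + p) in
        [/\ p <= z < N, ints s own z = ints s own p
          & forall x, p <= x < N -> x < p + 2 ^ L ->
              ints s own x = ints s own p -> ~~ ltk z x]) ->
     Q s') ->
  runs rnd (scan own lt) s (c * L.+1) (c * (6 * N)) Q.
Proof.
move=> N c o1 o2 Lh eN eT irr tr neg cont ltE post.
pose own' := ints s own.
set beats := fun y z => And (Bin Eq (Read own y) (Read own z)) (lt y z).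
have beatsE s' pid y z : same s s' -> eval s' pid (beats y z) =
    (own' (eval s' pid y) == own' (eval s' pid z)) && ltk (eval s' pid y) (eval s' pid z).
  by move=> ss; apply: eval_and; [case: ss => _ _ /= ->|rewrite ltE].
(* Level [k] of the tree, counted from the leaves, starts at cell [2 ^ (h - k)]; its node [q] stands
   for the block of [2 ^ k] positions from [q * 2 ^ k] on. *)
pose J j (A : nat -> nat) := forall k q, k < j -> q < 2 ^ (h - k) ->
  seg_max own' ltk (q * 2 ^ k) (2 ^ k) (A (2 ^ (h - k) + q)).
pose Iup l s' := exists j, [/\ j + l = L, same s s', ints s' rM 0 = 2 ^ (h - j)
  & J j.+1 (ints s' tree)].
(* In the downward sweep a node answers for a stretch that begins with its own block and is at least
   [2 ^ L] long unless the array ends. The length varies from node to node, so it is existential. *)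
pose cover p z := exists len, [/\ p + len <= N, 2 ^ L <= len \/ p + len = N
  & seg_max own' ltk p len z].
pose Idn l s' := [/\ same s s', ints s' rM 0 = 2 ^ (h - l), l <= L, J l (ints s' tree)
  & forall q, q < 2 ^ (h - l) -> cover (q * 2 ^ l) (ints s' tree (2 ^ (h - l) + q))].
have csS a b : cmd_size (Seq a b) = cmd_size a + cmd_size b by [].
have csW g b : cmd_size (While g b) = (expr_size g).+1 + cmd_size b by [].
have LN : L.+1 <= N by rewrite (leq_ltn_trans Lh) // ltn_expl.
have N0 : 0 < N by lia.
rewrite /c /scan -/beats 3!csS 2!csW 2!csS.
set node := Bin Add (Reg rM) Pid.
set g1 := Bin Lt (Reg rT) _; set g2 := Bin Lt (Reg rM) _.
set i1 := Par (Reg rN) _ _; set i2 := SetReg rM (Reg rN).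
set i3 := SetReg rM (Half _); set i4 := Par (Reg rM) (Const 1) _.
set i5 := SetReg rM (Double _); set i6 := Par (Reg rM) _ _.
set c1 := cmd_size i1; set c2 := cmd_size i2; set c3 := cmd_size i3.
set c4 := cmd_size i4; set c5 := cmd_size i5; set c6 := cmd_size i6.
have up l s' : Iup l.+1 s' -> eval s' 0 g1 != 0 /\
   runs rnd (Seq i3 i4) s' (c3 + c4) (c3 * 2 + c4 * (2 ^ (h - L + l)).+1) (Iup l).
  move=> [j [jl ss eM hJ]]; split.
    by case: (ss) => _ _ e3; rewrite /= (e3 rT) // eT eM ltn_exp2l //; lia.
  apply: (runs_seq (Q1 := fun s2 => [/\ same s s2, ints s2 rM 0 = 2 ^ (h - j.+1)
       & ints s2 tree = ints s' tree])).
    apply: runs_setreg; split=> //=; first exact: same_store.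
    by rewrite eM (_ : h - j = (h - j.+1).+1) ?expnS ?mul2n ?doubleK //; lia.
  move=> s2 [ss2 eM2 eA2].
  have hM : h - L + l = h - j.+1 by lia.
  have eP : eval s2 0 (Reg rM) = 2 ^ (h - j.+1) by rewrite /= eM2.
  rewrite hM -{1}eP.
  apply: (runs_store (2 ^ (h - j.+1))) => [i _|]; first by rewrite /= eM2.
  set M := 2 ^ (h - j.+1).
  have eM' : 2 ^ (h - j) = M + M.
    by rewrite (_ : h - j = (h - j.+1).+1) ?expnS ?mul2n ?addnn //; lia.
  exists j.+1; split; [lia|exact: same_store|by []|].
  move=> k q kj hq; rewrite ints_store eqxx /shift_row eP eA2 andbT.
  case: (ltnP k j.+1) => kj'.
    have : M + M <= 2 ^ (h - k) by rewrite -eM' leq_exp2l //; lia.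
    by case: ifP => [|_ _]; [lia|exact: hJ].
  have ek : k = j.+1 by lia.
  subst k; rewrite -/M in hq *; rewrite leq_addr ltn_add2l hq addKn !andTb.
  set y := ints s' tree (M + q + (M + q)); set z := ints s' tree (M + q + (M + q) + 1).
  (* [beats] is 0 or 1, so adding it to the address of the left child selects the winning child. *)
  set v := eval s2 q _; have -> : v = seg_pick own' ltk y z.
    rewrite -[v]/(ints s2 tree (eval s2 q (Double node) + eval s2 q
       (beats (Read tree (Double node)) (Read tree (Incr (Double node)))))).
    rewrite beatsE // /= eM2 -/M eA2 -/y -/z /seg_pick.
    by case: ifP => _; rewrite ?addn0.
  rewrite expnS mul2n -addnn.
  have -> : q * (2 ^ j + 2 ^ j) = (2 * q) * 2 ^ j by rewrite mulnDr; lia.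
  have hp : (2 * q) * 2 ^ j + 2 ^ j + 2 ^ j <= N.
    have -> : N = (M + M) * 2 ^ j by rewrite -eM' -expnD; congr (_ ^ _); lia.
    have : (q.+1 + q.+1) * 2 ^ j <= (M + M) * 2 ^ j by rewrite leq_mul2r; lia.
    by rewrite !mulnDl !mulSn; lia.
  apply: (seg_max_pick tr neg cont hp).
    have := hJ j (2 * q) (ltnSn _); rewrite eM' /y (_ : M + q + (M + q) = M + M + 2 * q); last lia.
    by apply; lia.
  have := hJ j (2 * q).+1 (ltnSn _); rewrite eM' /z (_ : M + q + (M + q) + 1 = M + M + (2 * q).+1); last lia.
  rewrite [X in seg_max _ _ X]mulSn [X in seg_max _ _ X]addnC.
  by apply; lia.
have dn l s' : Idn l.+1 s' -> eval s' 0 g2 != 0 /\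
   runs rnd (Seq i5 i6) s' (c5 + c6) (c5 * 2 + c6 * (2 ^ (h - l)).+1) (Idn l).
  move=> [ss eM lL hJ hC]; split.
    by case: (ss) => _ _ e3; rewrite /= (e3 rN) // eN eM ltn_exp2l //; lia.
  apply: (runs_seq (Q1 := fun s2 => [/\ same s s2, ints s2 rM 0 = 2 ^ (h - l)
       & ints s2 tree = ints s' tree])).
    apply: runs_setreg; split=> //=; first exact: same_store.
    by rewrite eM (_ : h - l = (h - l.+1).+1) ?expnS ?mul2n ?addnn //; lia.
  move=> s2 [ss2 eM2 eA2].
  have eP : eval s2 0 (Reg rM) = 2 ^ (h - l) by rewrite /= eM2.
  rewrite -{1}eP.
  apply: (runs_store (2 ^ (h - l))) => [i _|]; first by rewrite /= eM2.
  set M := 2 ^ (h - l); set M1 := 2 ^ (h - l.+1).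
  have eM' : M = M1 + M1.
    by rewrite /M (_ : h - l = (h - l.+1).+1) ?expnS ?mul2n ?addnn //; lia.
  have eNM : N = M * 2 ^ l by rewrite -expnD; congr (_ ^ _); lia.
  split; [exact: same_store|by []|lia| |].
    move=> k q kj hq; rewrite ints_store eqxx /shift_row eP eA2.
    have : M + M <= 2 ^ (h - k).
      rewrite addnn -mul2n -expnS leq_exp2l //; lia.
    by case: ifP => [|_ _]; [lia|apply: hJ => //; lia].
  move=> q hq; rewrite ints_store eqxx /shift_row eP eA2.
  rewrite leq_addr ltn_add2l hq addKn !andTb.
  have -> : eval s2 q (Or (Bin Eq (Double (Half node)) node)
       (And (Bin Lt (Incr node) (Double (Reg rM)))
            (beats (Read tree node) (Read tree (Half (Incr node)))))) =
     ((M + q)./2 + (M + q)./2 == M + q) || ((M + q + 1 < M + M) &&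
       ((own' (ints s' tree (M + q)) == own' (ints s' tree ((M + q + 1)./2))) &&
       ltk (ints s' tree (M + q)) (ints s' tree ((M + q + 1)./2)))).
    apply: eval_or; first by rewrite /= eM2.
    apply: eval_and; first by rewrite /= eM2.
    by rewrite beatsE //= eM2 -/M eA2.
  rewrite [eval _ _ _]/= eM2 -/M eA2.
  (* An even node begins where its parent begins and takes over the value of the parent. An odd node
     combines its own block with the stretch of the parent of its right neighbour, which begins
     right behind it; the last node has no such neighbour and already reaches [N].
     [Half (Incr node)] is the parent in question in both cases. *)
  case: (boolP (odd q)) => oq; last first.
    have [r er] : exists r, q = r + r by exists q./2; lia.
    have e1 : (M + q)./2 + (M + q)./2 == M + q by lia.
    have e2 : (M + q + 1)./2 = M1 + r by lia.
    rewrite e1 e2 /=.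
    have -> : q * 2 ^ l = r * 2 ^ l.+1 by rewrite expnS er; lia.
    by apply: hC; rewrite -/M1; lia.
  have [r er] : exists r, q = r + r + 1 by exists q./2; lia.
  have e1 : ((M + q)./2 + (M + q)./2 == M + q) = false by lia.
  have e2 : (M + q + 1)./2 = M1 + r.+1 by lia.
  rewrite e1 e2 /=.
  have gq : seg_max own' ltk (q * 2 ^ l) (2 ^ l) (ints s' tree (M + q)) by apply: hJ.
  case: ltnP => /= hMq; last first.
    have eq : q.+1 = M by lia.
    have e : q * 2 ^ l + 2 ^ l = N by rewrite eNM -eq mulSn addnC.
    by exists (2 ^ l); split; [lia|right|].
  have [len [len1 len2 gl]] := hC r.+1 ltac:(rewrite -/M1; lia).
  have er1 : r.+1 * 2 ^ l.+1 = q * 2 ^ l + 2 ^ l by rewrite expnS er; lia.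
  rewrite er1 -/M1 in len1 len2 gl.
  exists (2 ^ l + len); split; [lia|by case: len2 => ?; [left|right]; lia|].
  have := seg_max_pick tr neg cont len1 gq gl.
  by rewrite /seg_pick; case: ifP.
(* The level widths form geometric series, which is why both sweeps together do linear work. In
   [sumdn] the additional summand makes the induction close. *)
have sumup : \sum_(l < L) 2 ^ (h - L + l) <= N.
  have -> : N = 2 ^ (h - L) * 2 ^ L by rewrite -expnD; congr (_ ^ _); lia.
  move: (h - L) => a; elim: (L) => [|l IH]; first by rewrite big_ord0.
  rewrite big_ord_recr /= expnD expnS; move: IH; set S := \sum_(i < l) _.
  by set P := 2 ^ a * 2 ^ l; rewrite [_ * (2 * _)]mulnCA -/P; lia.
have sumdn : \sum_(l < L) 2 ^ (h - l) + 2 * 2 ^ (h - L) <= 2 * N.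
  elim: (L) Lh => [|l IH] lh; first by rewrite big_ord0 subn0; lia.
  rewrite big_ord_recr /=; have := IH ltac:(lia).
  have -> : 2 ^ (h - l) = 2 * 2 ^ (h - l.+1) by rewrite -expnS; congr (_ ^ _); lia.
  by set S := \sum_(i < l) _; lia.
have key : runs rnd (Seq i1 (Seq i2 (Seq (While g1 (Seq i3 i4)) (While g2 (Seq i5 i6)))))
   s (c1 + (c2 + ((expr_size g1).+1 * L.+1 + (c3 + c4) * L +
          ((expr_size g2).+1 * L.+1 + (c5 + c6) * L))))
     (c1 * N.+1 + (c2 * 2 + ((expr_size g1).+1 * L.+1 +
         \sum_(l < L) (c3 * 2 + c4 * (2 ^ (h - L + l)).+1) +
       ((expr_size g2).+1 * L.+1 +
         \sum_(l < L) (c5 * 2 + c6 * (2 ^ (h - l)).+1))))) Q.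
  apply: (runs_seq (Q1 := fun s' => same s s' /\ J 1 (ints s' tree))).
    have -> : N = eval s 0 (Reg rN) by rewrite /= eN.
    apply: (runs_store N) => [i _|]; first by rewrite /= eN.
    split; first exact: same_store.
    move=> k q; case: k => // _; rewrite subn0 => hq; rewrite /= /shift_row /= eN.
    by rewrite leq_addr ltn_add2l hq addKn muln1; apply: seg_max1.
  move=> s1 [ss1 hJ].
  apply: (runs_seq (Q1 := Iup L)).
    apply: runs_setreg; exists 0; split=> //; first exact: same_store.
    by case: ss1 => _ _ e /=; rewrite (e rN) // subn0.
  move=> s2 I2; apply: (runs_seq (Q1 := Iup 0)).
    apply: (runs_for (tb := c3 + c4) _ up I2) => s' [j [jL ss eM _]].
    case: (ss) => _ _ e; rewrite /= (e rT) // eT eM.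
    by rewrite (_ : j = L) ?ltnn //; lia.
  move=> s3 [j [jL ss3 eM3 hJ3]]; have ej : j = L by lia.
  subst j.
  have I3 : Idn L s3.
    split=> //.
    - by move=> k q kL; apply: hJ3; lia.
    - move=> q hq; exists (2 ^ L); split; [|by left|exact: hJ3].
      have -> : N = 2 ^ (h - L) * 2 ^ L by rewrite -expnD; congr (_ ^ _); lia.
      by rewrite -[X in _ + X]mul1n -mulnDl addn1 leq_mul2r hq orbT.
  have fin := runs_for (tb := c5 + c6) _ dn I3.
  apply: runs_weaken (fin _) (leqnn _) (leqnn _) _.
    move=> s' [ss eM _ _ _]; case: (ss) => _ _ e.
    by rewrite /= (e rN) // eN eM subn0 ltnn.
  move=> s' [ss eM _ _ hC]; apply: post => // p hp z.
  have [len [l1 l2 [g3 g4 g5 g6]]] := hC p ltac:(by rewrite subn0).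
  rewrite subn0 muln1 -/N -/z in l1 l2 g3 g4 g5 g6.
  split=> //; first lia.
  by move=> x hx hx2 ox; apply: g6 => //; case: l2 => ?; lia.
apply: (runs_weaken key) => // {post}.
  by nia.
have sumE a b (f : nat -> nat) : \sum_(l < L) (a * 2 + b * (f l).+1) =
    L * (a * 2 + b) + b * \sum_(l < L) f l.
  rewrite (eq_bigr (fun l : 'I_L => a * 2 + b + b * f l)) => [|l _]; last lia.
  by rewrite big_split /= sum_nat_const card_ord big_distrr.
move: sumup sumdn; clear key up dn; clearbody c1 c2 c3 c4 c5 c6.
rewrite (sumE c3 c4 (fun l => 2 ^ (h - L + l))) (sumE c5 c6 (fun l => 2 ^ (h - l))).
set S1 := \sum_(l < L) _; set S2 := \sum_(l < L) _ => hS1 hS2.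
have hS2' : S2 <= 2 * N by lia.
have LN' := ltnW LN.
have f1 := leq_mul (leqnn c3) LN'; have f2 := leq_mul (leqnn c4) LN'.
have f3 := leq_mul (leqnn c4) hS1; have f4 := leq_mul (leqnn c5) LN'.
have f5 := leq_mul (leqnn c6) LN'; have f6 := leq_mul (leqnn c6) hS2'.
have f7 := leq_mul (leqnn c1) N0; have f8 := leq_mul (leqnn c2) N0.
have [-> ->] : expr_size g1 = 5 /\ expr_size g2 = 5 by [].
clearbody S1 S2 N.
have -> : (c1 + (c2 + (6 + (c3 + c4) + (6 + (c5 + c6))))) * (6 * N) =
  6 * (c1 * N) + 6 * (c2 * N) + 6 * (c3 * N) + 6 * (c4 * N) + 6 * (c5 * N) +
  6 * (c6 * N) + 72 * N by ring.
have -> : c1 * N.+1 + (c2 * 2 + (6 * L.+1 + (L * (c3 * 2 + c4) + c4 * S1) +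
    (6 * L.+1 + (L * (c5 * 2 + c6) + c6 * S2)))) =
  c1 * N + c1 * 1 + 2 * (c2 * 1) + 12 * L.+1 + 2 * (c3 * L) + c4 * L + c4 * S1 +
  2 * (c5 * L) + c6 * L + c6 * S2 by ring.
have {f6} f6 : c6 * S2 <= 2 * (c6 * N) by rewrite (leq_trans f6) // mulnCA.
move: f1 f2 f3 f4 f5 f6 f7 f8 LN.
move: (c1 * N) (c1 * 1) (c2 * N) (c2 * 1) (c3 * N) (c3 * L) (c4 * N) (c4 * L) (c4 * S1)
  (c5 * N) (c5 * L) (c6 * N) (c6 * L) (c6 * S2) => *.
lia.
Qed.
End Scan.

(** * The program *)

Section Budget.
Variables (R : realType) (rnd : nat -> nat -> R) (L N : nat).
Implicit Types (s : pram_state R) (Q : pram_state R -> Prop).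

(** The budget of [runs_scan] serves for all commands: as [cmd_size] is additive, sequences compose
    without arithmetic. The factor 6 is not optimized. *)
Definition bruns c s Q := runs rnd c s (cmd_size c * L.+1) (cmd_size c * (6 * N)) Q.

Lemma bruns_seq c1 c2 s Q1 Q :
  bruns c1 s Q1 -> (forall s1, Q1 s1 -> bruns c2 s1 Q) -> bruns (Seq c1 c2) s Q.
Proof.
by move=> h1 h2; rewrite /bruns /= !mulnDl; apply: runs_seq h1 h2.
Qed.

Lemma bruns_store np g a x s Q :
  let p := eval s 0 np in 0 < N -> p <= N ->
  Q (store_state s a (fun k => if (k < p) && (eval s k g != 0) then eval s k x
                               else ints s a k)) ->
  bruns (Par np g (Store a Pid x)) s Q.
Proof.
move=> p N0 pN q.
have h : runs rnd (Par np g (Store a Pid x)) s (cmd_size (Par np g (Store a Pid x)))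
    (cmd_size (Par np g (Store a Pid x)) * p.+1) Q.
  apply: (runs_store 0) => //; move: q; congr (Q (store_state s a _)).
  by apply: funext => k; rewrite /shift_row leq0n add0n subn0.
by apply: runs_weaken h _ _ _ => //; [exact: leq_pmulr|rewrite leq_mul2l; lia].
Qed.

Lemma bruns_setreg a x s Q : 0 < N ->
  Q (store_state s a (fun k => if k == 0 then eval s 0 x else ints s a k)) ->
  bruns (SetReg a x) s Q.
Proof.
move=> N0 q; apply: runs_weaken (runs_setreg _ q) _ _ _ => //; first exact: leq_pmulr.
by rewrite leq_mul2l; lia.
Qed.

Lemma bruns_draw np s Q :
  let p := eval s 0 np in 0 < N -> p <= N ->
  Q (draw_state rnd s p) -> bruns (Par np (Const 1) (Draw 0 Pid)) s Q.
Proof.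
move=> p N0 pN q; apply: runs_weaken (runs_draw q) _ _ _ => //; first exact: leq_pmulr.
by rewrite leq_mul2l; lia.
Qed.

Lemma bruns_weaken c s Q Q' :
  bruns c s Q -> (forall s', Q s' -> Q' s') -> bruns c s Q'.
Proof. by move=> h hQ; apply: runs_weaken h _ _ hQ. Qed.

End Budget.

(* Arrays 0 to 4 are the input and array 5 the output; the names starting with r are
   registers, that is, cell 0 of an array. In the adjacency array of the vertices (of the
   hyperedges) [aOwnV] ([aOwnE]) holds [n - v] ([m - e]) at the positions of row [v] ([e])
   and 0 elsewhere. [aSel] holds [m - e] for the hyperedge [e] selected by a vertex, and 0
   if there is none; as [aNew] is 0 in cell [m], the cell [m - aSel] of [aNew] tells in both
   cases whether the vertex gets matched. *)
Local Notation aOffV := 1.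
Local Notation aV := 2.
Local Notation aOffE := 3.
Local Notation aE := 4.
Local Notation aOut := 5.
Local Notation aOwnV := 7.
Local Notation aOwnE := 8.
Local Notation aZero := 9.
Local Notation aLen := 10.
Local Notation aMarkV := 11.
Local Notation aMarkE := 12.
Local Notation aAct := 13.
Local Notation aSel := 14.
Local Notation aNew := 15.
Local Notation rT0 := 19.
Local Notation rK := 20.
Local Notation rFlag := 21.
Local Notation rS := 22.
Local Notation rD := 23.

Definition eN := Read 0 (Const 0).
Definition eM := Read 0 (Const 1).
Definition eK := Read 0 (Const 2).
Definition leaf x := Read tree (Bin Add (Reg rN) x).
Definition sel_code x := Read aSel (Read aE x).
(** All hyperedges draw a weight, the inactive ones too. With activity as the first component of the
    key, an inactive hyperedge can be the best one at a vertex only if no hyperedge there is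
    active. *)
Definition lt_weight y z :=
  let a x := Read aAct (Read aV x) in
  Or (Bin Lt (a y) (a z))
     (And (Bin Eq (a y) (a z)) (LtW 0 (Read aV y) 0 (Read aV z))).
Definition agrees x := Bin Eq (sel_code x) (Read aOwnE x).
Definition covered x := Read aNew (Bin Defs.Sub eM (sel_code x)).

(** The scan with the reversed order finds the smallest value of [agrees] in a row, which decides
    whether all vertices of a hyperedge selected it; the scan by [covered] decides whether some
    vertex gets matched. A vertex whose best hyperedge is inactive keeps the code 0. *)
Definition round_prog : cmd :=
  let best := Read aV (leaf (Read aOffV Pid)) in
  Seq (Par eM (Const 1) (Draw 0 Pid))
  (Seq (scan aOwnV lt_weight)
  (Seq (Par eN (Const 1) (Store aSel Pid (Const 0)))
  (Seq (Par eN (Read aAct best) (Store aSel Pid (Bin Defs.Sub eM best)))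
  (Seq (scan aOwnE (fun y z => Bin Lt (agrees z) (agrees y)))
  (Seq (Par eM (Const 1) (Store aNew Pid (agrees (leaf (Read aOffE Pid)))))
  (Seq (Par eM (Read aNew Pid) (Store aOut Pid (Const 1)))
  (Seq (scan aOwnE (fun y z => Bin Lt (covered y) (covered z)))
       (Par eM (covered (leaf (Read aOffE Pid))) (Store aAct Pid (Const 0)))))))))).

Definition maxkey (key : expr -> expr) y z := Bin Lt (key y) (key z).

(* The marks at the ends of the rows decrease, so the largest mark from [x] on is that of
   the row of [x]. *)
Definition owner_prog (k : expr) (off mark own : nat) : cmd :=
  Seq (Par k (Const 1)
         (Store mark (Bin Defs.Sub (Read off (Incr Pid)) (Const 1)) (Bin Defs.Sub k Pid)))
  (Seq (scan aZero (maxkey (Read mark)))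
       (Par eK (Const 1) (Store own Pid (Read mark (leaf Pid))))).

Definition row_len off := Bin Defs.Sub (Read off (Incr Pid)) (Read off Pid).

(** The first scan runs with [rT] equal to 1, hence at full height, and finds the largest row
    length. Doubling [rS] up to this length while halving [rT0] yields the truncation level without
    a division. As only the overall maximum matters, cell [i] of [aLen] can combine the rows [i] of
    both adjacency arrays. *)
Definition prep_prog : cmd :=
  Seq (SetReg rN (Const 1))
  (Seq (While (Bin Lt (Reg rN) eK) (SetReg rN (Double (Reg rN))))
  (Seq (SetReg rT (Const 1))
  (Seq (Par eN (Const 1) (Store aLen Pid (row_len aOffV)))
  (Seq (Par eM (Bin Lt (Read aLen Pid) (row_len aOffE)) (Store aLen Pid (row_len aOffE)))
  (Seq (scan aZero (maxkey (Read aLen)))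
  (Seq (SetReg rD (Read aLen (leaf (Const 0))))
  (Seq (SetReg rT0 (Reg rN))
  (Seq (SetReg rS (Const 1))
  (Seq (While (Bin Lt (Reg rS) (Reg rD))
          (Seq (SetReg rS (Double (Reg rS))) (SetReg rT0 (Half (Reg rT0)))))
  (Seq (SetReg rT (Reg rT0))
  (Seq (owner_prog eN aOffV aMarkV aOwnV)
  (Seq (owner_prog eM aOffE aMarkE aOwnE)
  (Seq (Par eM (Const 1) (Store aAct Pid (Const 1)))
       (SetReg rFlag (Const 1))))))))))))))).

(** Halving [m] until it is 0 takes exactly [lg m] steps, so the number of rounds need not be
    computed. *)
Definition rounds_prog : cmd :=
  Seq (SetReg rK eM)
      (While (Reg rK) (Seq round_prog (SetReg rK (Half (Reg rK))))).

(* Deciding whether an active hyperedge is left takes time of order log m, so this is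
   done once in lg m rounds only. *)
Definition check_prog : cmd :=
  Seq (SetReg rT (Const 1))
  (Seq (scan aZero (maxkey (Read aAct)))
  (Seq (SetReg rFlag (Read aAct (leaf (Const 0))))
       (SetReg rT (Reg rT0)))).

Definition lm_prog : cmd :=
  Seq prep_prog (While (Reg rFlag) (Seq rounds_prog check_prog)).

Section Keys.
Variables (R : realType) (f : nat -> nat) (g : nat -> R).

Definition lex_lt : rel nat :=
  fun y z => (f y < f z) || ((f y == f z) && (g y < g z)%R).

Lemma lex_lt_irr : irreflexive lex_lt.
Proof. by move=> x; rewrite /lex_lt ltnn eqxx ltxx. Qed.

Lemma lex_lt_trans : transitive lex_lt.
Proof.
move=> y x z; rewrite /lex_lt => /orP[h1|/andP[/eqP h1 h2]] /orP[h3|/andP[/eqP h3 h4]].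
- by rewrite (ltn_trans h1 h3).
- by rewrite -h3 h1.
- by rewrite h1 h3.
- by rewrite h1 h3 eqxx (lt_trans h2 h4) orbT.
Qed.

Lemma lex_lt_neg x y z : lex_lt y x -> lex_lt y z || lex_lt z x.
Proof.
rewrite /lex_lt; case: (ltngtP (f y) (f z)) => //= yz.
  by case/orP=> [h|/andP[/eqP <- _]]; rewrite ?yz //; rewrite (ltn_trans yz h).
rewrite yz; case: (ltngtP (f z) (f x)) => //= _ h; first by rewrite orbT.
by case: (ltP (g y) (g z)) => //= zy; apply: le_lt_trans h.
Qed.
End Keys.

Lemma natkey_irr (f : nat -> nat) : irreflexive (fun y z => f y < f z).
Proof. by move=> x; rewrite /= ltnn. Qed.

Lemma natkey_trans (f : nat -> nat) : transitive (fun y z => f y < f z).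
Proof. by move=> y x z /=; apply: ltn_trans. Qed.

Lemma natkey_neg (f : nat -> nat) x y z :
  f y < f x -> (f y < f z) || (f z < f x).
Proof. by case: (ltnP (f y) (f z)) => //= h1 h2; apply: leq_ltn_trans h2. Qed.

Section Rows.
Variables (k l : nat) (off flat own : nat -> nat) (inc : nat -> nat -> bool).

(** The compressed sparse row format. By [csr_lt] no row is empty, so the result of a scan for a row
    can be read off at the first position of the row. *)
Record csr : Prop := Csr {
  csr0 : off 0 = 0;
  csr_last : off k = l;
  csr_lt : forall i, i < k -> off i < off i.+1;
  csr_in : forall i x, i < k -> off i <= x < off i.+1 -> inc i (flat x);
  csr_ex : forall i j, i < k -> inc i j ->
    exists2 x, off i <= x < off i.+1 & flat x = j }.

(** Numbering the rows backwards keeps their labels positive, so that the cells behind the last row,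
    labelled 0, form a segment of their own. *)
Definition owned : Prop :=
  (forall i x, i < k -> off i <= x < off i.+1 -> own x = k - i) /\
  (forall x, l <= x -> own x = 0).

Hypothesis C : csr.

Lemma csr_mono i j : i <= j <= k -> off i <= off j.
Proof.
move=> /andP[]; elim: j => [|j IH]; first by case: i.
rewrite leq_eqVlt => /predU1P[->//|ij jk].
have := csr_lt C jk; have := IH ij (ltnW jk); lia.
Qed.

Lemma csr_row x : x < l -> exists2 i, i < k & off i <= x < off i.+1.
Proof.
move=> xl; pose P i := x < off i.
have exP : exists i, P i by exists k; rewrite /P (csr_last C).
have Pm : P (ex_minn exP) by case: ex_minnP.
case: ex_minnP => [[|i] Pi Mi] in Pm *; first by move: Pi; rewrite /P (csr0 C).
have ik : i < k.
  by rewrite -ltnS; have := Mi k; rewrite /P (csr_last C) => /(_ xl).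
exists i => //; rewrite -/(P i.+1) Pi andbT leqNgt.
by apply/negP => /Mi; rewrite ltnn.
Qed.

Lemma csr_rowE i j x : i < k -> j < k ->
  off i <= x < off i.+1 -> off j <= x < off j.+1 -> i = j.
Proof.
move=> ik jk hi hj; case: (ltngtP i j) => // ij.
  by have := @csr_mono i.+1 j; lia.
by have := @csr_mono j.+1 i; lia.
Qed.

Lemma csr_lt_last i x : i < k -> off i <= x < off i.+1 -> x < l.
Proof.
by move=> ik hx; have := @csr_mono i.+1 k; rewrite (csr_last C); lia.
Qed.

Hypothesis O : owned.

Lemma owned_row i x : i < k -> own x = k - i -> off i <= x < off i.+1.
Proof.
move=> ik ox; have [xl|lx] := ltnP x l; last by move: ox; rewrite O.2 //; lia.
have [i' ik' hx] := csr_row xl.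
by have := O.1 _ _ ik' hx; rewrite ox => e; have -> : i = i' by lia.
Qed.

Lemma owned_contig x y z : x <= y <= z -> own x = own z -> own y = own z.
Proof.
move=> xyz oxz; have [zl|lz] := ltnP z l.
  have [i ik hz] := csr_row zl; have oz := O.1 _ _ ik hz.
  have hx := owned_row ik (etrans oxz oz).
  by rewrite oz; apply: O.1 => //; lia.
have oz := O.2 _ lz; have [xl|lx] := ltnP x l.
  by have [i ik hx] := csr_row xl; move: oxz; rewrite (O.1 _ _ ik hx) oz; lia.
by rewrite oz; apply: O.2; lia.
Qed.
End Rows.

(** * One round and the preprocessing on the PRAM *)

Section RoundSpec.
Variables (R : realType) (n m : nat) (inc : nat -> nat -> bool).
Variables (W : nat -> R) (act : nat -> bool).

(* The round of the algorithm in terms of the numbers [i < n] and [j < m] of the vertices and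
   hyperedges; for tied weights a vertex may select several hyperedges here. *)
Definition idx_sel i j : bool :=
  [&& inc i j, act j &
      all (fun j' => inc i j' && act j' ==> (W j' <= W j)%R) (iota 0 m)].
Definition idx_new j : bool := all (fun i => inc i j ==> idx_sel i j) (iota 0 n).
Definition idx_cov i : bool := has (fun j => idx_sel i j && idx_new j) (iota 0 m).
Definition idx_act j : bool := act j && all (fun i => inc i j ==> ~~ idx_cov i) (iota 0 n).

Lemma idx_sel_uniq i j j' : {in [pred k | k < m] &, injective W} -> j < m -> j' < m ->
  idx_sel i j -> idx_sel i j' -> j = j'.
Proof.
move=> inj jm jm' /and3P[h1 h2 /allP h3] /and3P[h1' h2' /allP h3'].
apply: inj => //; apply/eqP; rewrite eq_le.
have := h3' j; rewrite mem_iota h1 h2 /= => -> //.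
by have := h3 j'; rewrite mem_iota h1' h2' /= => -> //.
Qed.
End RoundSpec.

Section Round.
Variables (R : realType) (rnd : nat -> nat -> R).
Variables (base : nat -> nat -> nat) (h L : nat) (inc : nat -> nat -> bool).
Implicit Types (s : pram_state R) (Q : pram_state R -> Prop).
Let n := base 0 0.
Let m := base 0 1.
Let kap := base 0 2.
Let N := 2 ^ h.

(** [base] is a snapshot of the integer memory after the preprocessing. The rounds leave the arrays
    in [statics] unchanged, so these facts are established once. *)
Record prepared : Prop := Prepared {
  prepV : csr n kap (base aOffV) (base aV) inc;
  prepE : csr m kap (base aOffE) (base aE) (fun j i => inc i j);
  prep_inc : forall i j, inc i j -> (i < n) && (j < m);
  prep_ownV : owned n kap (base aOffV) (base aOwnV);
  prep_ownE : owned m kap (base aOffE) (base aOwnE);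
  prep_zero : forall x, base aZero x = 0;
  prep_L : L <= h;
  prep_N : base rN 0 = N;
  prep_T : base rT 0 = 2 ^ (h - L);
  prep_T0 : base rT0 0 = 2 ^ (h - L);
  prep_size : [/\ n <= N, m <= N & kap <= N];
  prep_lenV : forall i, i < n -> base aOffV i.+1 <= base aOffV i + 2 ^ L;
  prep_lenE : forall j, j < m -> base aOffE j.+1 <= base aOffE j + 2 ^ L }.

Definition statics :=
  [:: 0; aOffV; aV; aOffE; aE; aOwnV; aOwnE; aZero; rN; rT; rT0].

Definition static s : Prop := forall a, a \in statics -> ints s a = base a.

Definition frame s s' : Prop :=
  forall a, a \notin [:: aOut; tree; aAct; aSel; aNew; rM] -> ints s' a = ints s a.

Lemma frame_trans s1 s2 s3 : frame s1 s2 -> frame s2 s3 -> frame s1 s3.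
Proof. by move=> h1 h2 a ha; rewrite h2 // h1. Qed.

Lemma frame_same s s' : same s s' -> frame s s'.
Proof.
by move=> [_ _ e] a ha; apply: e; apply: contra ha => /eqP ->.
Qed.

Lemma frame_store s a row : a \in [:: aOut; tree; aAct; aSel; aNew; rM] ->
  frame s (store_state s a row).
Proof.
move=> ha a' ha'; rewrite ints_store; case: eqP => // e.
by move: ha'; rewrite e ha.
Qed.

Lemma frame_static s s' : frame s s' -> static s -> static s'.
Proof.
move=> fr st a ha; rewrite fr ?st //.
by move: ha; rewrite !inE; do 10?case/orP=> [/eqP->//|]; move/eqP->.
Qed.

Hypothesis P : prepared.

Lemma N_gt0 : 0 < N. Proof. by rewrite expn_gt0. Qed.

(** As rows have length at most [2 ^ L], the window of the truncated scan at the first position of a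
    row contains the whole row, and the answer there is exact. *)
Lemma scan_rows own lt ltk k l off flat inc' s :
  static s -> own \in statics -> l <= N ->
  csr k l off flat inc' -> owned k l off (base own) ->
  (forall i, i < k -> off i.+1 <= off i + 2 ^ L) ->
  irreflexive ltk -> transitive ltk ->
  (forall x y z, ltk y x -> ltk y z || ltk z x) ->
  (forall s' pid y z, same s s' ->
     eval s' pid (lt y z) = ltk (eval s' pid y) (eval s' pid z)) ->
  bruns rnd L N (scan own lt) s (fun s' => same s s' /\
    forall i, i < k -> let z := ints s' tree (N + off i) in
      off i <= z < off i.+1 /\
      forall x, off i <= x < off i.+1 -> ~~ ltk z x).
Proof.
move=> st hown lN C O len irr tr neg ltE.
apply: (@runs_scan _ _ _ _ _ ltk h) => //.
- by move: hown; apply: contraTN => /eqP ->.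
- by move: hown; apply: contraTN => /eqP ->.
- exact: prep_L P.
- by rewrite st // prep_N.
- by rewrite st // prep_T.
- by move=> x y z xyz _; rewrite !st //; apply: owned_contig C O _ _ _ xyz.
move=> s' ss post; split=> // i ik z.
have hi : off i <= off i < off i.+1 by rewrite leqnn (csr_lt C).
have iN : off i < N by rewrite (leq_trans _ lN) // (csr_lt_last C ik hi).
have [] := post _ iN; rewrite -/z !st // => z1 z2 z3.
rewrite (O.1 _ _ ik hi) in z2 z3.
split=> [|x hx]; first exact: (owned_row C O).
apply: z3; last exact: O.1 hx.
- by have := csr_lt_last C ik hx; lia.
- by have := len _ ik; lia.
Qed.

(** The machine stores a single best hyperedge per vertex, while the specification admits every one
    of maximum weight. Injectivity of the weights makes the two agree. *)
Lemma runs_round s (act : nat -> bool) (W := rnd (draws s))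
    (new := idx_new n m inc W act) :
  static s -> {in [pred k | k < m] &, injective W} ->
  (forall j, j < m -> ints s aAct j = act j) ->
  ints s aNew m = 0 ->
  bruns rnd L N round_prog s (fun s' =>
    [/\ frame s s', draws s' = (draws s).+1, ints s' aNew m = 0,
        forall j, ints s' aAct j = if j < m then nat_of_bool (idx_act n m inc W act j) else ints s aAct j
      & forall j, j < m -> ints s' aOut j = if new j then 1 else ints s aOut j]).
Proof.
move=> st inj hact hnew.
have [nN mN kN] := prep_size P; have N0 := N_gt0.
have stc s' : frame s s' -> static s' by move=> fr; apply: frame_static fr st.
have sm s' : frame s s' -> eval s' 0 eM = m by move=> fr; rewrite /= (stc _ fr).
have sn s' : frame s s' -> eval s' 0 eN = n by move=> fr; rewrite /= (stc _ fr).
pose keep s' := [/\ frame s s', draws s' = (draws s).+1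
  & forall j, j < m -> weights s' 0 j = W j].
pose keepA s' := keep s' /\ ints s' aAct = ints s aAct.
have keep_same s1 s2 : keep s1 -> same s1 s2 -> keep s2.
  move=> [k1 k2 k3] ss; split; first exact: frame_trans k1 (frame_same ss).
    by case: ss => _ -> _.
  by case: ss => -> _ _.
have keep_store s1 a row : a \in [:: aOut; tree; aAct; aSel; aNew; rM] ->
    keep s1 -> keep (store_state s1 a row).
  by move=> ha [k1 k2 k3]; split=> //; apply: frame_trans k1 (frame_store _ _ ha).
apply: (bruns_seq (Q1 := fun s1 => keep s1 /\ ints s1 = ints s)).
  apply: bruns_draw => //; rewrite sm //.
  by split=> //; split=> // j jm; rewrite /= jm.
move=> s1 [k1 e1].
pose wlt := lex_lt (fun x => ints s aAct (base aV x)) (fun x => weights s1 0 (base aV x)).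
apply: (bruns_seq (Q1 := fun s2 => [/\ keep s2,
    forall a, a != tree -> a != rM -> ints s2 a = ints s a &
    forall i, i < n -> let z := ints s2 tree (N + base aOffV i) in
      base aOffV i <= z < base aOffV i.+1 /\
      forall x, base aOffV i <= x < base aOffV i.+1 -> ~~ wlt z x])).
  have st1 : static s1 by apply: stc; case: k1.
  apply: (bruns_weaken (@scan_rows aOwnV _ wlt n kap _ _ _ _ st1 _ kN (prepV P)
     (prep_ownV P) (prep_lenV P) _ _ _ _)) => //.
  - exact: lex_lt_irr.
  - exact: lex_lt_trans.
  - by move=> x y z; apply: lex_lt_neg.
  - move=> s' pid y z [w' d' ints'].
    apply: eval_or; rewrite /= !(ints' aAct) // !(ints' aV) // e1 (st aV) //.
    rewrite w'; set b1 := (_ == _); set b2 := (_ < _)%R.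
    by case: b1; case: b2.
  move=> s2 [ss hz]; split=> //; first exact: keep_same k1 ss.
  by case: ss => _ _ e a h1 h2; rewrite e // e1.
move=> s2 [k2 e2 hz].
pose best i := base aV (ints s2 tree (N + base aOffV i)).
have bestP i : i < n -> [/\ inc i (best i), best i < m & forall j, inc i j ->
    lex_lt (ints s aAct) W (best i) j = false].
  move=> ni; have [h1 h2] := hz i ni.
  have ib := csr_in (prepV P) ni h1; have /andP[_ bm] := prep_inc P ib.
  split=> // j ij; have [x hx <-] := csr_ex (prepV P) ni ij.
  have := h2 x hx; rewrite /wlt /lex_lt.
  have /andP[_ jm] := prep_inc P (csr_in (prepV P) ni hx).
  have [_ _ w1] := k1; rewrite !w1 //.
  by move/negbTE.
apply: (bruns_seq (Q1 := fun s3 => [/\ keep s3, forall a, a != tree -> a != rM ->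
    a != aSel -> ints s3 a = ints s a, ints s3 tree = ints s2 tree
  & forall i, i < n -> ints s3 aSel i = 0])).
  apply: bruns_store => //; rewrite sn //; try by case: k2.
  split=> //; first exact: keep_store.
    by move=> a h1 h2 h3; rewrite ints_store (negbTE h3) e2.
  by move=> i ni; rewrite /= ni.
move=> s3 [k3 e3 t3 z3].
apply: (bruns_seq (Q1 := fun s4 => [/\ keep s4, forall a, a != tree -> a != rM ->
    a != aSel -> ints s4 a = ints s a
  & forall i, i < n -> ints s4 aSel i = if act (best i) then m - best i else 0])).
  have st3 : static s3 by apply: stc; case: k3.
  apply: bruns_store => //; rewrite sn //; try by case: k3.
  split=> //; first exact: keep_store.
    by move=> a h1 h2 h3; rewrite ints_store (negbTE h3) e3.
  move=> i ni; rewrite /= ni (e3 aAct) // (st3 aV) // (st3 aOffV) // (st3 rN) // (st3 0) // (prep_N P) t3 -/N -/m -/(best i).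
  have [_ bm _] := bestP i ni.
  by rewrite hact // z3 //; case: (act _).
move=> s4 [k4 e4 sel4].
have selE i j : i < n -> j < m -> (ints s4 aSel i == m - j) = idx_sel m inc W act i j.
  move=> ni jm; rewrite sel4 //; have [h1 h2 h3] := bestP i ni.
  apply/idP/idP.
    case: ifP => [ab|_]; last by lia.
    move=> eb; have -> : j = best i by lia.
    rewrite /idx_sel h1 ab; apply/allP => j'; rewrite mem_iota => /andP[_ jm'].
    apply/implyP => /andP[ij' aj']; rewrite leNgt; apply/negP => lw.
    by have := h3 j' ij'; rewrite /lex_lt !hact // ab aj' lw orbT.
  move=> sp; have /and3P[ij aj /allP hj] := sp.
  have := h3 j ij; rewrite /lex_lt !hact // aj.
  case: (boolP (act (best i))) => // ab /= /negbT; rewrite -leNgt => lw.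
  suff -> : best i = j by [].
  apply: inj => //; apply/eqP; rewrite eq_le lw andbT.
  by have := hj (best i); rewrite mem_iota h1 ab /= => ->.
have sel0 i : i < n -> ints s4 aSel i = 0 \/ exists2 j, j < m & ints s4 aSel i = m - j.
  move=> ni; rewrite sel4 //; case: ifP => _; [right|by left].
  by exists (best i) => //; case: (bestP i ni).
pose ag x := nat_of_bool (ints s4 aSel (base aE x) == base aOwnE x).
have agE j x : j < m -> base aOffE j <= x < base aOffE j.+1 ->
    ag x = idx_sel m inc W act (base aE x) j.
  move=> jm hx; rewrite /ag ((prep_ownE P).1 j x jm hx) selE //.
  by have /andP[] := prep_inc P (csr_in (prepE P) jm hx).
have rowsE (Pr : nat -> bool) j : j < m ->
    all (fun i => inc i j ==> Pr i) (iota 0 n) <->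
    forall x, base aOffE j <= x < base aOffE j.+1 -> Pr (base aE x).
  move=> jm; split=> [/allP hP x hx|hP].
    have ij := csr_in (prepE P) jm hx; have /andP[ni _] := prep_inc P ij.
    by have := hP (base aE x); rewrite mem_iota ni ij => /(_ isT).
  apply/allP => i _; apply/implyP => ij; have [x hx <-] := csr_ex (prepE P) jm ij.
  exact: hP.
apply: (bruns_seq (Q1 := fun s5 => [/\ keep s5,
    forall a, a != tree -> a != rM -> a != aSel -> ints s5 a = ints s a,
    ints s5 aSel = ints s4 aSel &
    forall j, j < m -> let z := ints s5 tree (N + base aOffE j) in
      base aOffE j <= z < base aOffE j.+1 /\
      forall x, base aOffE j <= x < base aOffE j.+1 -> ~~ (ag x < ag z)])).
  have st4 : static s4 by apply: stc; case: k4.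
  apply: (bruns_weaken (@scan_rows aOwnE _ (fun y z => ag z < ag y) m kap _ _ _ _ st4 _ kN
    (prepE P) (prep_ownE P) (prep_lenE P) _ _ _ _)) => //.
  - by move=> x; rewrite ltnn.
  - by move=> y x z xy yz; apply: ltn_trans yz xy.
  - by move=> x y z xy; rewrite orbC; apply: natkey_neg.
  - move=> s' pid y z [w' d' ints'].
    by rewrite /ag /= !(ints' aSel) // !(ints' aE) // !(ints' aOwnE) // !(st4 aE) // !(st4 aOwnE).
  move=> s5 [ss hz5]; split=> //; first exact: keep_same k4 ss.
    by case: ss => _ _ e a h1 h2 h3; rewrite e // e4.
  by case: ss => _ _ ->.
move=> s5 [k5 e5 sl5 hz5].
apply: (bruns_seq (Q1 := fun s6 => [/\ keep s6, forall a, a != tree -> a != rM ->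
    a != aSel -> a != aNew -> ints s6 a = ints s a, ints s6 aSel = ints s4 aSel,
    ints s6 aNew m = 0 & forall j, j < m -> ints s6 aNew j = new j])).
  have st5 : static s5 by apply: stc; case: k5.
  apply: bruns_store => //; rewrite sm //; try by case: k5.
  split=> //; first exact: keep_store.
  - by move=> a h1 h2 h3 h4; rewrite ints_store (negbTE h4) e5.
  - by rewrite /= ltnn /= (e5 aNew).
  move=> j jm; rewrite /= jm /= (st5 aE) // (st5 aOffE) // (st5 rN) // (st5 aOwnE) // (prep_N P) sl5 -/N.
  have [h1 h2] := hz5 j jm; set z := ints s5 tree _ in h1 h2 *.
  rewrite -/(ag z) (agE j) //; congr nat_of_bool.
  apply/idP/idP => [az|].
    apply/(rowsE _ j jm) => x hx; have := h2 x hx.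
    by rewrite (agE j) // (agE j) // az; case: (idx_sel _ _ _ _ _ _).
  by move/(rowsE _ j jm); apply.
move=> s6 [k6 e6 sl6 nm6 n6].
apply: (bruns_seq (Q1 := fun s7 => [/\ keep s7, ints s7 aAct = ints s aAct,
    ints s7 aSel = ints s4 aSel, ints s7 aNew = ints s6 aNew
    & forall j, j < m -> ints s7 aOut j = if new j then 1 else ints s aOut j])).
  apply: bruns_store => //; rewrite sm //; try by case: k6.
  split=> //; [exact: keep_store|exact: e6|].
  by move=> j jm; rewrite /= jm n6 // e6 //; case: (new j).
move=> s7 [k7 a7 sl7 nw7 out7].
pose cv x := ints s6 aNew (m - ints s4 aSel (base aE x)).
have covE i : i < n -> ints s6 aNew (m - ints s4 aSel i) = idx_cov n m inc W act i.
  move=> ni; case: (sel0 i ni) => [sl|[j jm sl]]; rewrite sl.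
    rewrite subn0 nm6; symmetry; apply/eqP; rewrite eqb0; apply/hasPn => j.
    rewrite mem_iota => /andP[_ jm]; rewrite -selE // sl negb_and.
    by apply/orP; left; lia.
  have sj : idx_sel m inc W act i j by rewrite -selE // sl.
  rewrite subKn 1?ltnW // n6 //; congr nat_of_bool; apply/idP/hasP.
    by move=> nj; exists j; rewrite ?mem_iota // sj.
  case=> j'; rewrite mem_iota => /andP[_ jm'] /andP[sj' nj'].
  by rewrite (idx_sel_uniq inj jm jm' sj sj').
have cvE j x : j < m -> base aOffE j <= x < base aOffE j.+1 ->
    cv x = idx_cov n m inc W act (base aE x).
  by move=> jm hx; apply: covE; have /andP[] := prep_inc P (csr_in (prepE P) jm hx).
apply: (bruns_seq (Q1 := fun s8 => [/\ keep s8, ints s8 aAct = ints s aAct,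
    ints s8 aNew = ints s6 aNew /\ ints s8 aSel = ints s4 aSel,
    ints s8 aOut = ints s7 aOut &
    forall j, j < m -> let z := ints s8 tree (N + base aOffE j) in
      base aOffE j <= z < base aOffE j.+1 /\
      forall x, base aOffE j <= x < base aOffE j.+1 -> ~~ (cv z < cv x)])).
  have st7 : static s7 by apply: stc; case: k7.
  apply: (bruns_weaken (@scan_rows aOwnE _ (fun y z => cv y < cv z) m kap _ _ _ _ st7 _ kN
    (prepE P) (prep_ownE P) (prep_lenE P) (natkey_irr cv) (@natkey_trans cv) (@natkey_neg cv) _)) => //.
  - move=> s' pid y z [w' d' ints'].
    by rewrite /cv /= !(ints' aNew) // !(ints' aSel) // !(ints' aE) // !(ints' 0) // !(st7 aE) // !(st7 0) // sl7 nw7.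
  move=> s8 [ss hz8]; case: (ss) => _ _ e; split=> //; rewrite ?e //.
  exact: keep_same k7 ss.
move=> s8 [k8 a8 [nw8 sl8] o8 hz8].
have st8 : static s8 by apply: stc; case: k8.
apply: bruns_store => //; rewrite sm //; try by case: k8.
have k9 := fun row => keep_store s8 aAct row isT k8.
split.
- by case: (k9 (fun k : nat => if (k < m) && (eval s8 k (covered (leaf (Read aOffE Pid))) != 0)
      then eval s8 k (Const 0) else ints s8 aAct k)).
- by case: k8.
- by rewrite ints_store nw8.
- move=> j; rewrite ints_store eqxx; case: ltnP => jm /=; last by rewrite a8.
  rewrite (st8 aE) // (st8 aOffE) // (st8 rN) // (st8 0) // (prep_N P) nw8 sl8 -/N -/m.
  have [h1 h2] := hz8 j jm; set z := ints s8 tree _ in h1 h2 *.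
  rewrite -/(cv z) (cvE j) // a8 hact //.
  have -> : idx_act n m inc W act j = act j && ~~ idx_cov n m inc W act (base aE z).
    rewrite /idx_act; congr (_ && _); apply/idP/idP => [/(rowsE (fun i => ~~ idx_cov n m inc W act i) j jm)|ncz].
      by apply.
    apply/(rowsE (fun i => ~~ idx_cov n m inc W act i) j jm) => x hx.
    by have := h2 x hx; rewrite (cvE j) // (cvE j) // (negbTE ncz); case: (idx_cov _ _ _ _ _ _).
  by case: (idx_cov _ _ _ _ _ _); case: (act j).
- by move=> j jm; rewrite ints_store /= o8 out7.
Qed.
End Round.

(** * Preprocessing: tree size, scan height, owners of positions *)

Lemma up_log_lg D : up_log 2 D <= lg D.
Proof. by apply: up_log_min => //; apply: ltnW; apply: trunc_log_ltn. Qed.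

Section Prep.
Variables (R : realType) (rnd : nat -> nat -> R).
Implicit Types (s : pram_state R) (Q : pram_state R -> Prop).

(** For loops on registers: at most [L] iterations of constant cost, and [L < N] lets them fit the
    work budget. *)
Lemma bruns_for (L N : nat) (I : nat -> pram_state R -> Prop) g c l s :
  l <= L -> L < N ->
  (forall s, I 0 s -> eval s 0 g = 0) ->
  (forall l s, I l.+1 s -> eval s 0 g != 0 /\ runs rnd c s (cmd_size c) (cmd_size c * 2) (I l)) ->
  I l s -> bruns rnd L N (While g c) s (I 0).
Proof.
move=> lL LN h0 hS Il.
have := runs_for (rnd := rnd) (tb := cmd_size c) (wb := fun=> cmd_size c * 2) h0 hS Il.
move=> hr; apply: runs_weaken hr _ _ _ => //=.
  rewrite mulnDl leq_add // leq_mul2l //; lia.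
rewrite sum_nat_const card_ord mulnDl leq_add //.
  by rewrite leq_mul2l; lia.
by rewrite mulnC -mulnA leq_mul2l; lia.
Qed.

Section Owner.
Variables (h L k l : nat) (ek : expr) (off mark own : nat).
Variables (flat : nat -> nat) (inc : nat -> nat -> bool).
Let N := 2 ^ h.

Lemma runs_owner s :
  csr k l (ints s off) flat inc ->
  eval s 0 ek = k -> (forall pid s', ints s' 0 = ints s 0 -> eval s' pid ek = k) ->
  eval s 0 eK = l -> k <= N -> l <= N ->
  ints s rN 0 = N -> L <= h -> ints s rT 0 = 2 ^ (h - L) ->
  uniq [:: mark; own; 0; off; aZero; tree; rM; rN; rT] ->
  (forall x, ints s aZero x = 0) -> (forall x, ints s mark x = 0) ->
  (forall x, ints s own x = 0) ->
  (forall i, i < k -> ints s off i.+1 <= ints s off i + 2 ^ L) ->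
  bruns rnd h N (owner_prog ek off mark own) s (fun s' =>
    [/\ forall a, a \notin [:: tree; rM; mark; own] -> ints s' a = ints s a,
        draws s' = draws s & owned k l (ints s off) (ints s' own)]).
Proof.
move=> C ek0 ekE eK0 kN lN eN Lh eT un zz mz oz len.
have N0 : 0 < N by rewrite expn_gt0.
have hN : h < N by exact: ltn_expl.
have [[m1 m2 m3 m4] [m5 m6 m7 m8]] : [/\ mark != own, mark != 0, mark != off & mark != aZero] /\
  [/\ mark != tree, mark != rM, mark != rN & mark != rT].
  by move: un; rewrite /= !inE !negb_or => /andP[/and4P[-> -> -> /and5P[-> -> -> -> ->]] _].
have [[q1 q2 q3] [q4 q5 q6]] : [/\ own != 0, own != off & own != aZero] /\
  [/\ own != tree, own != rM & own != rN].
  by move: un; rewrite /= !inE !negb_or => /and3P[_ /and3P[-> -> /and5P[-> -> -> -> _]] _].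
pose last_ i := ints s off i.+1 - 1.
have lastP i : i < k -> ints s off i <= last_ i < ints s off i.+1.
  by move=> ik; have := csr_lt C ik; rewrite /last_; lia.
have lastI i j : i < k -> j < k -> last_ i = last_ j -> i = j.
  by move=> ik jk e; apply: (csr_rowE C ik jk (lastP _ ik)); rewrite e; apply: lastP.
pose mk x := if [pick i : 'I_k | last_ i == x] is Some i then k - i else 0.
have mkE i : i < k -> mk (last_ i) = k - i.
  move=> ik; rewrite /mk; case: pickP => [j /eqP e|/(_ (Ordinal ik))]; last by rewrite /= eqxx.
  by rewrite (lastI _ _ (ltn_ord j) ik e).
have mk0 x : 0 < mk x -> exists2 i, i < k & x = last_ i.
  by rewrite /mk; case: pickP => // i /eqP <- _; exists i.
apply: (bruns_seq (Q1 := fun s1 => s1 = store_state s mark mk)).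
  set i1 := Par _ _ _.
  have hr : runs rnd i1 s (cmd_size i1) (cmd_size i1 * (eval s 0 ek).+1)
      (fun s1 => s1 = store_state s mark mk).
    apply: (@runs_store_gen _ _ _ _ _ _ _ _ mk) => //.
    - by move=> i j; rewrite ek0 => ik jk _ _; rewrite /= !addn1; apply: lastI.
    - move=> i; rewrite ek0 => ik _; rewrite /= ekE // addn1; exact: mkE.
    - move=> x hx; rewrite mz /mk; case: pickP => // i /eqP e; exfalso.
      have := hx i; rewrite ek0 => /(_ (ltn_ord i) isT); rewrite /= addn1.
      by rewrite -e /last_ eqxx.
  apply: runs_weaken hr _ _ _ => //; first exact: leq_pmulr.
  by rewrite leq_mul2l ek0; lia.
move=> s1 e1.
have f1 a : a != mark -> ints s1 a = ints s a by rewrite e1 ints_store => /negbTE ->.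
have mk1 : ints s1 mark = mk by rewrite e1 ints_store eqxx.
apply: (bruns_seq (Q1 := fun s2 => same s1 s2 /\
   forall p, p < l -> forall i, i < k -> ints s off i <= p < ints s off i.+1 ->
     mk (ints s2 tree (N + p)) = k - i)).
  have hr : runs rnd (scan aZero (maxkey (Read mark))) s1
     (cmd_size (scan aZero (maxkey (Read mark))) * L.+1)
     (cmd_size (scan aZero (maxkey (Read mark))) * (6 * N)) (fun s2 => same s1 s2 /\
   forall p, p < l -> forall i, i < k -> ints s off i <= p < ints s off i.+1 ->
     mk (ints s2 tree (N + p)) = k - i).
    apply: (@runs_scan _ _ _ _ _ (fun y z => mk y < mk z) h) => //.
    - by rewrite f1 1?eq_sym.
    - by rewrite f1 1?eq_sym.
    - exact: natkey_irr.
    - exact: natkey_trans.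
    - exact: natkey_neg.
    - by move=> x y z _ _; rewrite f1 1?eq_sym // !zz.
    - by move=> s' pid y z [_ _ e]; rewrite /maxkey /= e // mk1.
    move=> s2 ss post; split=> // p pl i ik hp.
    have [] := post p (leq_trans pl lN); set z := ints s2 tree _ => /andP[z1 z2] _ z3.
    have hl := lastP i ik.
    have hl' : last_ i < N.
      by rewrite (leq_trans _ lN) // (csr_lt_last C ik hl).
    have pli : p <= last_ i < N by rewrite hl' andbT /last_; lia.
    have := z3 (last_ i) pli _ _; rewrite mkE // f1 1?eq_sym // !zz -leqNgt => /(_ _ erefl) h1.
    have {}h1 : k - i <= mk z by apply: h1; have := len i ik; lia.
    (* The winner is the end of some row [j]. Its mark is at least that of row [i], so [j <= i]; it
       does not lie before [p], so [j] is not smaller than [i]. *)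
    have [j jk ej] : exists2 j, j < k & z = last_ j by apply: mk0; lia.
    rewrite ej mkE // in h1 *.
    have ji : j <= i by lia.
    suff -> : j = i by [].
    apply/eqP; rewrite eqn_leq ji leqNgt; apply/negP => ij.
    by have := csr_mono C (i := j.+1) (j := i); have := lastP j jk; lia.
  by apply: runs_weaken hr _ _ _ => //; rewrite leq_mul2l; lia.
move=> s2 [[_ d2 f2] h2].
have eN2 : ints s2 rN 0 = N by rewrite f2 // f1 1?eq_sym.
have eK2 : eval s2 0 eK = l by rewrite /= f2 // f1 1?eq_sym.
apply: bruns_store => //; rewrite eK2 //.
split.
- move=> a; rewrite !inE !negb_or => /and4P[a1 a2 a3 a4].
  by rewrite ints_store (negbTE a4) f2 // f1.
- by rewrite /= d2 e1.
- have mk2 : ints s2 mark = mk by rewrite f2.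
  split=> [i x ik hx|x lx]; rewrite ints_store eqxx.
    have xl := csr_lt_last C ik hx.
    by rewrite xl /= eN2 mk2 (h2 x xl i ik hx).
  by rewrite ltnNge lx /= f2 // f1 1?eq_sym // oz.
Qed.
End Owner.

Definition changed_in (s0 : pram_state R) (l : seq nat) s : Prop :=
  draws s = draws s0 /\ forall a, a \notin l -> ints s a = ints s0 a.

Lemma changed_in_store s0 l a row s :
  changed_in s0 l s -> changed_in s0 (a :: l) (store_state s a row).
Proof.
move=> [d e]; split=> // a'; rewrite inE negb_or ints_store => /andP[/negbTE -> ha].
exact: e.
Qed.

Lemma changed_in_store_in s0 l a row s : a \in l ->
  changed_in s0 l s -> changed_in s0 l (store_state s a row).
Proof.
move=> al [d e]; split=> // a' ha'; rewrite ints_store.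
by case: eqP => [ea|_]; [move: ha'; rewrite ea al|exact: e].
Qed.

Lemma changed_in_same s0 l s s' : changed_in s0 l s -> same s s' -> changed_in s0 (tree :: rM :: l) s'.
Proof.
move=> [d e] [_ d' e']; split=> [|a]; first by rewrite d'.
by rewrite !inE !negb_or => /and3P[a1 a2 a3]; rewrite e' // e.
Qed.

Lemma changed_in_trans s0 l1 l2 l s s' :
  changed_in s0 l1 s -> changed_in s l2 s' -> all (mem l) (l1 ++ l2) -> changed_in s0 l s'.
Proof.
move=> [d1 e1] [d2 e2] /allP sub; split=> [|a al]; first by rewrite d2.
by rewrite e2 ?e1 //; apply: contra al => ?; apply: sub; rewrite mem_cat;
  apply/orP; [left|right].
Qed.

Lemma runs_prep s0 (inc : nat -> nat -> bool) (lmax : nat)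
    (n := ints s0 0 0) (m := ints s0 0 1) (kap := ints s0 0 2) :
  0 < kap -> n <= kap -> m <= kap -> lmax <= kap ->
  csr n kap (ints s0 aOffV) (ints s0 aV) inc ->
  csr m kap (ints s0 aOffE) (ints s0 aE) (fun j i => inc i j) ->
  (forall i j, inc i j -> (i < n) && (j < m)) ->
  (forall i, i < n -> ints s0 aOffV i.+1 - ints s0 aOffV i <= lmax) ->
  (forall j, j < m -> ints s0 aOffE j.+1 - ints s0 aOffE j <= lmax) ->
  (forall a x, 4 < a -> ints s0 a x = 0) ->
  let h := up_log 2 kap in
  bruns rnd h (2 ^ h) prep_prog s0 (fun s => exists L,
    [/\ L <= lg lmax, prepared (ints s) h L inc, draws s = draws s0,
        forall j, ints s aAct j = (j < m)
      & [/\ forall j, ints s aNew j = 0, forall j, ints s aOut j = 0, ints s rFlag 0 = 1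
          & ints s 0 = ints s0 0]]).
Proof.
move=> k0 nk mk lk CV CE incb lenV lenE z0 h.
set N := 2 ^ h.
have N0 : 0 < N by rewrite expn_gt0.
have hN : h < N by exact: ltn_expl.
have kN : kap <= N by exact: up_logP.
have nN : n <= N by lia.
have mN : m <= N by lia.
apply: (bruns_seq (Q1 := fun s => changed_in s0 [:: rN] s /\ ints s rN 0 = 1)).
  by apply: bruns_setreg => //; split=> //; apply: changed_in_store.
move=> s1 [c1 e1].
pose I1 l s := [/\ changed_in s0 [:: rN] s, l <= h & ints s rN 0 = 2 ^ (h - l)].
apply: (bruns_seq (Q1 := I1 0)).
  apply: (bruns_for (leqnn h)) => //; last by split=> //; rewrite subnn.
    by move=> s [[_ e] _ eN]; rewrite /= (e 0) // eN subn0 -/N -/kap ltnNge kN.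
  move=> l s [[d e] lh eN]; split.
    rewrite /= (e 0) // eN -/kap; case: ltnP => // hk.
    by have := up_log_min (isT : 1 < 2) hk; rewrite -/h; lia.
  apply: runs_setreg; split; [exact: changed_in_store_in|lia|].
  rewrite /= eN; have -> : h - l = (h - l.+1).+1 by lia.
  by rewrite expnS mul2n addnn.
move=> s2 [c2 _]; rewrite subn0 -/N => eN2.
apply: (bruns_seq (Q1 := fun s => [/\ changed_in s0 [:: rT; rN] s, ints s rN 0 = N
    & ints s rT 0 = 1])).
  by apply: bruns_setreg => //; split=> //; apply: changed_in_store.
move=> s3 [c3 eN3 eT3].
pose lV i := ints s0 aOffV i.+1 - ints s0 aOffV i.
pose lE i := ints s0 aOffE i.+1 - ints s0 aOffE i.
apply: (bruns_seq (Q1 := fun s => [/\ changed_in s0 [:: aLen; rT; rN] s, ints s rN 0 = N,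
    ints s rT 0 = 1 & forall i, ints s aLen i = if i < n then lV i else 0])).
  have e3 := c3.2.
  apply: bruns_store => //; rewrite /= (e3 0) // -/n //; split=> //.
    exact: changed_in_store.
  by move=> i; rewrite /= (e3 aOffV) // (e3 aLen) // addn1 andbT (z0 aLen).
move=> s4 [c4 eN4 eT4 len4].
apply: (bruns_seq (Q1 := fun s => [/\ changed_in s0 [:: aLen; rT; rN] s, ints s rN 0 = N,
    ints s rT 0 = 1 & [/\ forall i, i < n -> lV i <= ints s aLen i,
      forall i, i < m -> lE i <= ints s aLen i & forall i, ints s aLen i <= lmax]])).
  have e4 := c4.2.
  apply: bruns_store => //; rewrite /= (e4 0) // -/m //; split=> //.
    exact: changed_in_store_in.
  have rowE i : (if (i < m) && (nat_of_bool (ints s4 aLen i < ints s4 aOffE (i + 1) - ints s4 aOffE i) != 0)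
       then ints s4 aOffE (i + 1) - ints s4 aOffE i else ints s4 aLen i) =
     if (i < m) && (ints s4 aLen i < lE i) then lE i else ints s4 aLen i.
    by rewrite (e4 aOffE) // addn1 -/(lE i) eqb0 negbK.
  split=> i; rewrite rowE.
  - by move=> ni; rewrite len4 ni; case: ifP => // /andP[_ /ltnW].
  - by move=> mi; rewrite mi /=; case: ltnP.
  - case: ifP => [/andP[mi _]|_]; first exact: lenE.
    by rewrite len4; case: ifP => // ni; apply: lenV.
move=> s5 [c5 eN5 eT5 [len5 len5' len5'']].
apply: (bruns_seq (Q1 := fun s => [/\ changed_in s0 [:: tree; rM; aLen; rT; rN] s, ints s rN 0 = N
   & [/\ ints s aLen = ints s5 aLen & forall x, x < N -> ints s5 aLen x <= ints s5 aLen (ints s tree (N + 0))]])).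
  (* Full height, and the constant array [aZero] as owner makes everything one segment: the answer
     at position 0 is a global maximum. *)
  apply: (@runs_scan _ _ _ _ _ (fun y z => ints s5 aLen y < ints s5 aLen z) h) => //.
  - by rewrite subnn.
  - exact: natkey_irr.
  - exact: natkey_trans.
  - exact: natkey_neg.
  - by move=> x y z _ _ _; rewrite (c5.2 aZero) // !z0.
  - by move=> s' pid y z [_ _ e]; rewrite /maxkey /= e.
  move=> s' ss post; split; [exact: changed_in_same c5 ss|by case: ss => _ _ ->|].
  split; first by case: ss => _ _ ->.
  move=> x xN; rewrite leqNgt; have [_ _] := post 0 N0; apply=> //.
  by rewrite (c5.2 aZero) // !z0.
move=> s6 [c6 eN6 [l6 max6]].
set D := ints s5 aLen (ints s6 tree (N + 0)) in max6.
apply: (bruns_seq (Q1 := fun s => [/\ changed_in s0 [:: rD; tree; rM; aLen; rT; rN] s,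
    ints s rN 0 = N & ints s rD 0 = D])).
  by apply: bruns_setreg => //; split=> //; [exact: changed_in_store|rewrite /= eN6 l6].
move=> s7 [c7 eN7 eD7].
apply: (bruns_seq (Q1 := fun s => [/\ changed_in s0 [:: rT0; rD; tree; rM; aLen; rT; rN] s,
    ints s rN 0 = N, ints s rD 0 = D & ints s rT0 0 = N])).
  by apply: bruns_setreg => //; split=> //; exact: changed_in_store.
move=> s8 [c8 eN8 eD8 eT8].
pose ch9 := [:: rS; rT0; rD; tree; rM; aLen; rT; rN].
apply: (bruns_seq (Q1 := fun s => [/\ changed_in s0 ch9 s,
    ints s rN 0 = N, ints s rD 0 = D & ints s rT0 0 = N /\ ints s rS 0 = 1])).
  by apply: bruns_setreg => //; split=> //; exact: changed_in_store.
move=> s9 [c9 eN9 eD9 [eT9 eS9]].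
pose L := up_log 2 D.
have Dl : D <= lmax by exact: len5''.
have Lh : L <= h by apply: leq_up_log; lia.
pose I2 l s := [/\ changed_in s0 ch9 s, ints s rN 0 = N, ints s rD 0 = D,
   ints s rT0 0 = 2 ^ (h - L + l) & l <= L /\ ints s rS 0 = 2 ^ (L - l)].
apply: (bruns_seq (Q1 := I2 0)).
  apply: (bruns_for Lh) => //.
  - move=> s [_ _ eD _ [_ eS]]; rewrite /= eD eS subn0 ltnNge.
    by rewrite (up_logP _ (isT : 1 < 2)).
  - move=> l s [ch eN eD eT [lL eS]]; split.
      rewrite /= eD eS; case: ltnP => // hk.
      by have := up_log_min (isT : 1 < 2) hk; rewrite -/L; lia.
    have sz : cmd_size (Seq (SetReg rS (Double (Reg rS))) (SetReg rT0 (Half (Reg rT0)))) * 2 =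
       cmd_size (SetReg rS (Double (Reg rS))) * 2 + cmd_size (SetReg rT0 (Half (Reg rT0))) * 2 by [].
    rewrite sz; apply: (runs_seq (Q1 := fun s => [/\ changed_in s0 ch9 s, ints s rN 0 = N,
      ints s rD 0 = D, ints s rT0 0 = 2 ^ (h - L + l.+1) & ints s rS 0 = 2 ^ (L - l)])).
      apply: runs_setreg; split=> //; first exact: changed_in_store_in.
      rewrite /= eS; have -> : L - l = (L - l.+1).+1 by lia.
      by rewrite expnS mul2n addnn.
    move=> s' [ch' eN' eD' eT' eS'].
    apply: runs_setreg; split=> //; first exact: changed_in_store_in.
      by rewrite /= eT' addnS expnS mul2n doubleK.
    by split=> //; lia.
  - by split=> //; rewrite ?subnn // subnK.
move=> s10 [c10 eN10 _]; rewrite addn0 => eT10 _.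
apply: (bruns_seq (Q1 := fun s => [/\ changed_in s0 ch9 s, ints s rN 0 = N,
    ints s rT0 0 = 2 ^ (h - L) & ints s rT 0 = 2 ^ (h - L)])).
  by apply: bruns_setreg => //; split=> //; exact: changed_in_store_in.
move=> s11 [c11 eN11 eT011 eT11].
have wL : D <= 2 ^ L by exact: up_logP.
have wV i : i < n -> ints s0 aOffV i.+1 <= ints s0 aOffV i + 2 ^ L.
  move=> ni; have := len5 i ni; have := max6 i ltac:(lia).
  rewrite /lV; lia.
have wE i : i < m -> ints s0 aOffE i.+1 <= ints s0 aOffE i + 2 ^ L.
  move=> mi; have := len5' i mi; have := max6 i ltac:(lia).
  rewrite /lE; lia.
have e11 := c11.2.
apply: (bruns_seq (Q1 := fun s => [/\ changed_in s0 (aOwnV :: aMarkV :: ch9) s, ints s rN 0 = N,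
    ints s rT0 0 = 2 ^ (h - L) /\ ints s rT 0 = 2 ^ (h - L)
  & owned n kap (ints s0 aOffV) (ints s aOwnV)])).
  have CV' : csr n kap (ints s11 aOffV) (ints s0 aV) inc by rewrite e11.
  apply: (bruns_weaken (@runs_owner h L _ _ eN aOffV aMarkV aOwnV _ _ _ CV' _ _ _ _ _ _ Lh _ _ _ _ _ _)) => //.
  - by rewrite /= e11.
  - by move=> pid s' /= ->; rewrite e11.
  - by rewrite /= e11.
  - by move=> x; rewrite e11 // z0.
  - by move=> x; rewrite e11 // z0.
  - by move=> x; rewrite e11 // z0.
  - by move=> i ni; rewrite !e11 // wV.
  move=> s [e d o]; rewrite e11 // in o; rewrite (e rN) // (e rT0) // (e rT) //; split=> //.
  have c : changed_in s11 [:: tree; rM; aMarkV; aOwnV] s by split.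
  exact: changed_in_trans c11 c _.
move=> s12 [c12 eN12 [eT012 eT12] oV].
pose ch13 := [:: aOwnE, aMarkE, aOwnV, aMarkV & ch9].
have e12 := c12.2.
apply: (bruns_seq (Q1 := fun s => [/\ changed_in s0 ch13 s, ints s rN 0 = N,
    ints s rT0 0 = 2 ^ (h - L) /\ ints s rT 0 = 2 ^ (h - L)
  & owned n kap (ints s0 aOffV) (ints s aOwnV) /\
    owned m kap (ints s0 aOffE) (ints s aOwnE)])).
  have CE' : csr m kap (ints s12 aOffE) (ints s0 aE) (fun j i => inc i j) by rewrite e12.
  apply: (bruns_weaken (@runs_owner h L _ _ eM aOffE aMarkE aOwnE _ _ _ CE' _ _ _ _ _ _ Lh _ _ _ _ _ _)) => //.
  - by rewrite /= e12.
  - by move=> pid s' /= ->; rewrite e12.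
  - by rewrite /= e12.
  - by move=> x; rewrite e12 // z0.
  - by move=> x; rewrite e12 // z0.
  - by move=> x; rewrite e12 // z0.
  - by move=> i ni; rewrite !e12 // wE.
  move=> s [e d o]; rewrite e12 // in o; rewrite (e rN) // (e rT0) // (e rT) // (e aOwnV) //; split=> //.
  have c : changed_in s12 [:: tree; rM; aMarkE; aOwnE] s by split.
  exact: changed_in_trans c12 c _.
move=> s13 [c13 eN13 [eT013 eT13] [oV13 oE13]].
have e13 := c13.2.
apply: (bruns_seq (Q1 := fun s => [/\ changed_in s0 (aAct :: ch13) s,
    forall a, a != aAct -> ints s a = ints s13 a
  & forall j, ints s aAct j = (j < m)])).
  apply: bruns_store => //; rewrite /= (e13 0) // -/m //; split.
  - exact: changed_in_store.
  - by move=> a /negbTE /= ->.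
  by move=> j; rewrite /= andbT (e13 aAct) // z0 //; case: (_ < _).
move=> s14 [c14 e14 act14].
apply: bruns_setreg => //; set s15 := store_state _ _ _.
have f15 a : a != rFlag -> ints s15 a = ints s14 a by rewrite ints_store => /negbTE ->.
have c15 : changed_in s0 [:: rFlag, aAct & ch13] s15 by apply: changed_in_store.
have e15 := c15.2.
exists L; split.
- by rewrite (leq_trans (leq_up_log 2 Dl)) // up_log_lg.
- split; rewrite ?(e15 0) // ?(e15 aOffV) // ?(e15 aV) // ?(e15 aOffE) // ?(e15 aE) //.
  + by rewrite f15 // e14.
  + by rewrite f15 // e14.
  + by move=> x; rewrite e15 // z0.
  + by rewrite f15 // e14.
  + by rewrite f15 // e14.
  + by rewrite f15 // e14.
- by case: c15.
- by move=> j; rewrite f15.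
- split; [| | |exact: e15] => //.
  + by move=> j; rewrite e15 // z0.
  + by move=> j; rewrite e15 // z0.
Qed.
End Prep.

(** * The local max algorithm and its implementation *)

Section LocalMaxRound.
Variables (R : realType) (V : finType) (E : {set {set V}}).
Hypothesis E0 : finset.set0 \notin E.
Implicit Types (S : lm_state V) (w : {set V} -> R) (e : {set V}) (v : V).

Definition lm_new w S : {set {set V}} :=
  [set e in act_edges S | [forall v in e, selection S w v == Some e]].

Lemma lm_roundE w S : lm_round w S =
  LMState (act_vertices S :\: finset.cover (lm_new w S))
    [set e in act_edges S | [disjoint e & finset.cover (lm_new w S)]]
    (matched S :|: lm_new w S).
Proof. by []. Qed.

Definition lm_wf S : Prop :=
  act_edges S \subset E /\ forall e, e \in act_edges S -> e \subset act_vertices S.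

Lemma lm_wf0 : lm_wf (LMState finset.setT E finset.set0).
Proof. by split=> //= e _; apply: finset.subsetT. Qed.

Lemma lm_wf_round w S : lm_wf S -> lm_wf (lm_round w S).
Proof.
move=> [h1 h2]; rewrite lm_roundE; split=> /=.
  by apply: fintype.subset_trans h1; apply/fintype.subsetP => e; rewrite inE => /andP[].
move=> e; rewrite inE => /andP[ea ed]; rewrite finset.subsetD h2 //=.
Qed.

Lemma selection_some S w v e : selection S w v = Some e ->
  [/\ e \in act_edges S, v \in e & forall e', e' \in act_edges S -> v \in e' -> (w e' <= w e)%R].
Proof.
rewrite /selection; case: ifP => // _; case: pickP => // e1.
move=> /and3P[h1 h2 /forallP h3] [<-]; split=> // e' h4 h5.
by have := h3 e'; rewrite h4 h5.
Qed.

Lemma in_new w S e : e \in lm_new w S ->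
  e \in act_edges S /\ forall v, v \in e -> selection S w v = Some e.
Proof. by rewrite inE => /andP[h1 /forall_inP h2]; split=> // v /h2 /eqP. Qed.

Lemma lm_wf_run (w : nat -> {set V} -> R) r : lm_wf (lm_run E w r).
Proof. by elim: r => [|r IH]; [exact: lm_wf0|exact: lm_wf_round]. Qed.

(** Two new hyperedges with a common vertex would both be the selection of that vertex, and matched
    ones are disjoint from all active ones. The last clause records why a hyperedge stopped being
    active; it yields maximality in the end. *)
Lemma lm_matching (w : nat -> {set V} -> R) r (S := lm_run E w r) :
  [/\ matched S \subset E, finset.trivIset (matched S),
      forall e, e \in act_edges S -> [disjoint e & finset.cover (matched S)]
    & forall e, e \in E -> [\/ e \in act_edges S, e \in matched S |
        ~~ [disjoint e & finset.cover (matched S)]]].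
Proof.
rewrite {}/S; elim: r => [|r IH].
  split=> /= [|| e _|e ->]; rewrite ?finset.sub0set //; last by constructor.
    by apply/finset.trivIsetP => A B; rewrite inE.
  by rewrite /finset.cover big_set0 -finset.setI_eq0 finset.setI0.
have [wf1 wf2] := lm_wf_run w r.
rewrite -[lm_run E w r.+1]/(lm_round (w r) (lm_run E w r)).
move: IH wf1 wf2; set S := lm_run E w r => -[m1 m2 m3 m4] wf1 wf2.
rewrite lm_roundE /=; set new := lm_new (w r) S.
have cU : finset.cover (matched S :|: new) = finset.cover (matched S) :|: finset.cover new.
  by rewrite /finset.cover finset.bigcup_setU.
have newE e : e \in new -> e \in act_edges S by move/in_new => [].
split.
- rewrite finset.subUset m1 /=; apply/fintype.subsetP => e /newE.
  exact: (fintype.subsetP wf1).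
- apply/finset.trivIsetP => A B; rewrite 2!finset.in_setU => hA hB AB.
  have dis A' B' : A' \in matched S -> B' \in new -> [disjoint A' & B'].
    move=> hA' /newE /m3; rewrite disjoint_sym; apply: disjointWl.
    exact: finset.bigcup_sup.
  case/orP: hA => hA; case/orP: hB => hB.
  + by apply: (finset.trivIsetP m2).
  + exact: dis.
  + by rewrite disjoint_sym; apply: dis.
  + case: (boolP [disjoint A & B]) => // /pred0Pn.
    move=> [v /andP[/= vA vB]]; case/eqP: AB.
    have [_ /(_ v vA) sA] := in_new hA; have [_ /(_ v vB) sB] := in_new hB.
    by move: sB; rewrite sA => -[].
- move=> e; rewrite inE => /andP[ea ed]; rewrite cU.
  rewrite -finset.setI_eq0 finset.setIUr finset.setU_eq0 !finset.setI_eq0.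
  by rewrite m3.
- move=> e /m4 h; rewrite cU; case: h => [ea|em|nd].
  + case: (boolP [disjoint e & finset.cover new]) => [d|nd].
      by apply: Or31; rewrite inE ea.
    by apply: Or33; apply: contra nd; apply: disjointWr; apply: finset.subsetUr.
  + by apply: Or32; rewrite inE em.
  + by apply: Or33; apply: contra nd; apply: disjointWr; apply: finset.subsetUl.
Qed.

Lemma lm_maximal (w : nat -> {set V} -> R) r (S := lm_run E w r) :
  act_edges S = finset.set0 -> is_maximal_matching E (matched S).
Proof.
move=> a0; have [m1 m2 _ m4] := lm_matching w r; rewrite -/S in m1 m2 m4.
rewrite /is_maximal_matching /is_matching m1 m2 /=.
apply/forall_inP => e; rewrite inE => /andP[neM eE].
rewrite negb_and; apply/orP; right; apply/negP => /finset.trivIsetP tr.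
have [] := m4 _ eE; rewrite ?a0 ?inE // ?(negbTE neM) //.
move/negP; apply; apply: finset.bigcup_disjoint => f fM; apply: tr; rewrite ?inE ?eqxx ?fM ?orbT //.
by apply: contraNneq neM => ->.
Qed.
End LocalMaxRound.

(** * From numbers of vertices and hyperedges to sets *)

Section Link.
Variables (R : realType) (V : finType) (E : {set {set V}}).
Variables (vs : seq V) (es : seq {set V}).
Hypotheses (Pvs : perm_eq vs (enum V)) (Pes : perm_eq es (enum E)).
Hypothesis E0 : finset.set0 \notin E.
Implicit Types (v : V) (e : {set V}).

Definition nthe (j : nat) : {set V} := nth finset.set0 es j.

Definition incidence (i j : nat) : bool :=
  (j < #|E|) && [exists v : V, (index v vs == i) && (v \in nthe j)].

Lemma size_es : size es = #|E|. Proof. by rewrite (perm_size Pes) cardE. Qed.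
Lemma size_vs : size vs = #|V|. Proof. by rewrite (perm_size Pvs) cardE. Qed.
Lemma uniq_es : uniq es. Proof. by rewrite (perm_uniq Pes) enum_uniq. Qed.
Lemma mem_es e : (e \in es) = (e \in E).
Proof. by rewrite (perm_mem Pes) mem_enum. Qed.
Lemma mem_vs v : v \in vs.
Proof. by rewrite (perm_mem Pvs) mem_enum. Qed.
Lemma index_vs v : index v vs < #|V|.
Proof. by rewrite -size_vs index_mem mem_vs. Qed.
Lemma index_vs_inj v v' : index v vs = index v' vs -> v = v'.
Proof. by move=> e; rewrite -(nth_index v (mem_vs v)) e nth_index ?mem_vs. Qed.
Lemma index_es e : e \in E -> index e es < #|E|.
Proof. by rewrite -size_es index_mem mem_es. Qed.
Lemma nthe_index e : e \in E -> nthe (index e es) = e.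
Proof. by move=> eE; rewrite /nthe nth_index ?mem_es. Qed.
Lemma index_nthe j : j < #|E| -> index (nthe j) es = j.
Proof. by move=> jm; rewrite /nthe index_uniq ?uniq_es ?size_es. Qed.
Lemma nthe_in j : j < #|E| -> nthe j \in E.
Proof. by move=> jm; rewrite -mem_es mem_nth // size_es. Qed.

Lemma ex_vertex i : i < #|V| -> exists v, index v vs = i.
Proof.
move=> ni; case: vs size_vs Pvs => [|v0 vs'] sz pv; first by move: ni; rewrite -sz.
exists (nth v0 (v0 :: vs') i); rewrite index_uniq ?sz //.
by rewrite (perm_uniq pv) enum_uniq.
Qed.

Lemma incidenceE v e : e \in E -> incidence (index v vs) (index e es) = (v \in e).
Proof.
move=> eE; rewrite /incidence index_es //= nthe_index //.
apply/existsP/idP => [[v' /andP[/eqP /index_vs_inj -> //]]|ve].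
by exists v; rewrite eqxx.
Qed.

Lemma incidence_lt i j : incidence i j -> (i < #|V|) && (j < #|E|).
Proof. by move=> /andP[-> /existsP[v /andP[/eqP <- _]]]; rewrite index_vs. Qed.

Lemma edge_ind (P : nat -> Prop) :
  (forall e, e \in E -> P (index e es)) -> forall j, j < #|E| -> P j.
Proof. by move=> h j jm; rewrite -(index_nthe jm); apply: h; apply: nthe_in. Qed.

Section OneRound.
Variables (W : nat -> R) (S : lm_state V).
Hypothesis inj : {in [pred k | k < #|E|] &, injective W}.
Hypothesis wf : lm_wf E S.
Let w e := W (index e es).
Let act j := (j < #|E|) && (nthe j \in act_edges S).
Let n := #|V|.
Let m := #|E|.

Lemma act_in e : e \in act_edges S -> e \in E.
Proof. by apply: (fintype.subsetP wf.1). Qed.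

Lemma actE e : e \in E -> act (index e es) = (e \in act_edges S).
Proof. by move=> eE; rewrite /act index_es // nthe_index. Qed.

Lemma w_inj e e' : e \in E -> e' \in E -> w e = w e' -> e = e'.
Proof.
move=> eE eE' /inj; rewrite !inE !index_es // => /(_ isT isT) h.
by rewrite -(nthe_index eE) h nthe_index.
Qed.

(** [selection] picks some hyperedge of maximum weight; as the weights are distinct, there is only
    one candidate. *)
Lemma idx_selE v e : e \in E ->
  idx_sel m incidence W act (index v vs) (index e es) = (selection S w v == Some e).
Proof.
move=> eE; apply/idP/eqP => [/and3P[]|].
  rewrite incidenceE // actE // => ve ea /allP mx.
  have mx' e' : e' \in act_edges S -> v \in e' -> (w e' <= w e)%R.
    move=> ea' ve'; have eE' := act_in ea'.
    have := mx (index e' es); rewrite mem_iota /= index_es //.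
    by rewrite incidenceE // actE // ea' ve' => /(_ isT).
  rewrite /selection (fintype.subsetP (wf.2 _ ea)) //.
  case: pickP => [e1 /and3P[ea1 ve1 /forallP mx1]|/(_ e)]; last first.
    rewrite ea ve /= => /negbT /forallPn[e']; rewrite !negb_imply.
    by case/and3P=> h1 h2; rewrite mx'.
  congr Some; apply: w_inj => //; first exact: act_in.
  by apply/eqP; rewrite eq_le mx' //=; have := mx1 e; rewrite ea ve.
move=> /selection_some[ea ve mx]; rewrite /idx_sel incidenceE // ve actE // ea /=.
apply/allP => j; rewrite mem_iota => /andP[_]; move: j; apply: edge_ind => e' eE'.
by apply/implyP; rewrite incidenceE // actE // => /andP[h1 h2]; apply: mx.
Qed.

Lemma all_vertices (Pr : nat -> bool) e : e \in E ->
  all (fun i => incidence i (index e es) ==> Pr i) (iota 0 n) =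
  [forall v in e, Pr (index v vs)].
Proof.
move=> eE; apply/allP/forall_inP => [h v ve|h i].
  by have := h (index v vs); rewrite mem_iota index_vs incidenceE // ve => /(_ isT).
rewrite mem_iota => /andP[_ ni]; have [v <-] := ex_vertex ni.
by apply/implyP; rewrite incidenceE //; apply: h.
Qed.

Lemma idx_newE e : e \in E -> idx_new n m incidence W act (index e es) = (e \in lm_new w S).
Proof.
move=> eE; rewrite /idx_new all_vertices //.
apply/forall_inP/idP => [h|/in_new[_ h] v ve]; last by rewrite idx_selE // h.
have {}h v : v \in e -> selection S w v = Some e by move=> /h; rewrite idx_selE // => /eqP.
(* [idx_new] tests activity only through the vertices, so it would hold vacuously for an empty
   hyperedge. *)
have /finset.set0Pn[v ve] : e != finset.set0 by apply: contraNneq E0 => <-.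
have [ea _ _] := selection_some (h v ve).
by rewrite inE ea; apply/forall_inP => u /h ->.
Qed.

Lemma idx_covE v : idx_cov n m incidence W act (index v vs) = (v \in finset.cover (lm_new w S)).
Proof.
apply/hasP/finset.bigcupP => [[j]|[e en ve]].
  rewrite mem_iota => /andP[_]; move: j; apply: edge_ind => e eE.
  rewrite idx_selE // idx_newE // => /andP[/eqP /selection_some[_ ve _] en].
  by exists e.
have [ea /(_ v ve) sv] := in_new en; have eE := act_in ea.
by exists (index e es); rewrite ?mem_iota ?index_es // idx_selE // idx_newE // sv eqxx.
Qed.

Lemma idx_actE e : e \in E ->
  idx_act n m incidence W act (index e es) = (e \in act_edges (lm_round w S)).
Proof.
move=> eE; rewrite lm_roundE /= inE /idx_act actE //; congr (_ && _).
rewrite (all_vertices (fun i => ~~ idx_cov n m incidence W act i)) // disjoint_subset.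
apply/forall_inP/fintype.subsetP => h v ve; have := h v ve; rewrite idx_covE.
  by rewrite inE.
by rewrite inE.
Qed.
End OneRound.
End Link.

(** * Correctness and cost of the main loop *)

Section MainLoop.
Variables (R : realType) (rnd : nat -> nat -> R) (V : finType) (E : {set {set V}}).
Variables (vs : seq V) (es : seq {set V}).
Hypotheses (Pvs : perm_eq vs (enum V)) (Pes : perm_eq es (enum E)).
Hypothesis E0 : finset.set0 \notin E.
Let w (r : nat) (e : {set V}) : R := rnd r (index e es).
Let m := #|E|.
Implicit Types (s : pram_state R).

Section Loop.
Variables (base : nat -> nat -> nat) (h L : nat).
Hypothesis P : prepared base h L (incidence E vs es).
Hypotheses (bn : base 0 0 = #|V|) (bm : base 0 1 = #|E|).
Let N := 2 ^ h.

Definition round_inv r s : Prop :=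
  [/\ static base s, draws s = r, ints s aNew m = 0,
      forall j, ints s aAct j = (j < m) && (nthe es j \in act_edges (lm_run E w r))
    & forall j, j < m -> ints s aOut j = (nthe es j \in matched (lm_run E w r))].

Lemma runs_round_inv r s :
  {in [pred k | k < m] &, injective (rnd r)} -> round_inv r s ->
  bruns rnd L N round_prog s (fun s' => round_inv r.+1 s' /\ ints s' rK = ints s rK).
Proof.
move=> inj [st dr nm ac ou]; subst r.
pose S := lm_run E w (draws s).
have wf : lm_wf E S by exact: lm_wf_run.
pose act j := (j < m) && (nthe es j \in act_edges S).
have actj j : j < base 0 1 -> ints s aAct j = act j by rewrite ac.
have inj' : {in [pred k | k < base 0 1] &, injective (rnd (draws s))} by rewrite bm.
have nm' : ints s aNew (base 0 1) = 0 by rewrite bm.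
apply: bruns_weaken (runs_round P st inj' actj nm') _ => s'.
rewrite bm bn => -[fr d nm1 ac1 ou1]; split; last by rewrite fr.
split=> //.
- by apply: frame_static fr st.
- move=> j; rewrite ac1; case: ltnP => jm /=; last by rewrite ac ltnNge jm.
  move: j jm; apply: (edge_ind Pes) => e eE.
  by rewrite (idx_actE Pvs Pes E0 inj wf) // (nthe_index Pes).
move=> j jm; rewrite ou1 // ou //.
move: j jm; apply: (edge_ind Pes) => e eE.
rewrite (idx_newE Pvs Pes E0 inj wf) // (nthe_index Pes) //.
rewrite -[lm_run E w (draws s).+1]/(lm_round (w (draws s)) S) lm_roundE [matched _]/=.
rewrite finset.in_setU orbC.
by case: (e \in lm_new _ _).
Qed.

(** The number of binary digits, which decreases by one under halving as long as it is positive. *)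
Definition bits k := if k == 0 then 0 else lg k.

Lemma runs_rounds r s :
  0 < m ->
  (forall r', r <= r' < r + lg m -> {in [pred k | k < m] &, injective (rnd r')}) ->
  round_inv r s ->
  runs rnd rounds_prog s (cmd_size rounds_prog * (L.+1 * (lg m).+1))
    (cmd_size rounds_prog * (6 * N * (lg m).+1)) (round_inv (r + lg m)).
Proof.
move=> m0 inj ri; have N0 : 0 < N by rewrite expn_gt0.
pose I l s := exists r', [/\ round_inv r' s, r' + l = r + lg m, l <= lg m & bits (ints s rK 0) = l].
set body := Seq round_prog (SetReg rK (Half (Reg rK))).
have step l s' : I l.+1 s' -> eval s' 0 (Reg rK) != 0 /\
    runs rnd body s' (cmd_size body * L.+1) (cmd_size body * (6 * N)) (I l).
  move=> [r' [ri' rl lm hb]]; split; first by move: hb; rewrite /= /bits; case: eqP.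
  have rr : r <= r' < r + lg m by lia.
  apply: (bruns_seq (runs_round_inv (inj _ rr) ri')) => s1 [ri1 k1].
  apply: bruns_setreg => //; exists r'.+1; split; [|lia|lia|].
    case: ri1 => h1 h2 h3 h4 h5; split=> // a ha.
    by rewrite ints_store -h1 //; case: eqP => // ea; move: ha; rewrite ea.
  rewrite /= k1; move: hb; rewrite /bits.
  case: eqP => // /eqP k0; case: (ltngtP (ints s' rK 0) 1) => [||->]; first by case: (ints _ _ _) k0.
    move=> k1'; rewrite /lg trunc_log2S //.
    have -> : (ints s' rK 0)./2 == 0 = false by lia.
    by move=> [->].
  by rewrite /lg trunc_log1 => -[<-].
have fin s' : I 0 s' -> eval s' 0 (Reg rK) = 0.
  by move=> [r' [_ _ _]]; rewrite /= /bits; case: eqP.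
pose c1 := cmd_size (SetReg rK eM).
have hr : runs rnd rounds_prog s (c1 + ((expr_size (Reg rK)).+1 * (lg m).+1 + cmd_size body * L.+1 * lg m))
   (c1 * 2 + ((expr_size (Reg rK)).+1 * (lg m).+1 + \sum_(i < lg m) cmd_size body * (6 * N))) (I 0).
  apply: (runs_seq (Q1 := I (lg m))).
    apply: runs_setreg; exists r; split=> //.
      case: ri => h1 h2 h3 h4 h5; split=> // a ha.
      by rewrite ints_store -h1 //; case: eqP => // ea; move: ha; rewrite ea.
    case: ri => h1 _ _ _ _; rewrite /= h1 // bm /bits.
    by case: eqP => // e; move: m0; rewrite /m e.
  move=> s1 I1; exact: runs_for fin step _ _ I1.
have csE : cmd_size rounds_prog = c1 + ((expr_size (Reg rK)).+1 + cmd_size body) by [].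
rewrite csE; clear csE step fin; clearbody c1.
move: (cmd_size body) hr => cb hr.
apply: runs_weaken hr _ _ _.
- rewrite mulnDl leq_add ?leq_pmulr ?muln_gt0 //.
  rewrite mulnDl leq_add //; first by rewrite leq_mul2l leq_pmull.
  by rewrite -mulnA !leq_mul.
- rewrite mulnDl leq_add //; first by rewrite leq_mul2l; nia.
  rewrite sum_nat_const card_ord mulnDl leq_add //; first by rewrite leq_mul2l leq_pmull ?muln_gt0.
  by rewrite mulnCA leq_mul2l [lg m * _]mulnC leq_mul2l leqnSn !orbT.
by move=> s' [r' [ri' e _ _]]; have -> : r + lg m = r' by lia.
Qed.

Lemma runs_check r s : round_inv r s ->
  bruns rnd h N check_prog s (fun s' => round_inv r s' /\
    ints s' rFlag 0 = (act_edges (lm_run E w r) != finset.set0)).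
Proof.
move=> [st dr nm ac ou]; have N0 : 0 < N by rewrite expn_gt0.
(* [static] is an equality of whole arrays. To restore it for [rT] at the end, all cells of this
   array but the first are tracked too. *)
pose F s' := [/\ draws s' = r, forall a, a \notin [:: rT; tree; rM; rFlag] -> ints s' a = ints s a
  & forall k, k != 0 -> ints s' rT k = ints s rT k].
apply: (bruns_seq (Q1 := fun s1 => F s1 /\ ints s1 rT 0 = 1)).
  apply: bruns_setreg => //; split=> //; split=> // [a|[|k]] //.
  by rewrite ints_store !inE !negb_or => /and4P[/negbTE -> _ _ _].
move=> s1 [[d1 f1 g1] t1].
apply: (bruns_seq (Q1 := fun s2 => F s2 /\ forall x, x < N ->
    ints s aAct x <= ints s aAct (ints s2 tree (N + 0)))).
  apply: (@runs_scan _ _ _ _ _ (fun y z => ints s aAct y < ints s aAct z) h) => //.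
  - by rewrite f1 // st // (prep_N P).
  - by rewrite subnn.
  - exact: natkey_irr.
  - exact: natkey_trans.
  - exact: natkey_neg.
  - by move=> x y z _ _ _; rewrite f1 // st // !(prep_zero P).
  - by move=> s' pid y z [_ _ e]; rewrite /maxkey /= e // f1.
  move=> s' [_ d' e'] post; split.
    split=> [|a ha|k k0]; [by rewrite d'| |by rewrite e' // g1].
    by rewrite e' ?f1 //; move: ha; rewrite !inE !negb_or => /and4P[].
  move=> x xN; rewrite leqNgt; have [_ _] := post 0 N0; apply=> //.
  by rewrite f1 // st // !(prep_zero P).
move=> s2 [[d2 f2 g2] mx].
apply: (bruns_seq (Q1 := fun s3 => F s3 /\
    ints s3 rFlag 0 = (act_edges (lm_run E w r) != finset.set0))).
  apply: bruns_setreg => //; split.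
    split=> // a; move=> ha; rewrite ints_store; case: eqP => [ea|_]; last exact: f2.
    by move: ha; rewrite ea.
  rewrite /= (f2 rN) // st // (prep_N P) f2 // -/N; set z := ints s2 _ _ in mx *.
  have sub := (lm_wf_run E w r).1.
  case: (finset.set_0Vmem (act_edges (lm_run E w r))) => [a0|[e ea]].
    by rewrite ac a0 inE eqxx andbF.
  have eE : e \in E by exact: (fintype.subsetP sub).
  have := mx (index e es); rewrite [ints s aAct (index _ _)]ac (index_es Pes eE) (nthe_index Pes) // ea.
  have [_ mN _] := prep_size P; rewrite bm in mN.
  rewrite (leq_trans (index_es Pes eE) mN) => /(_ isT).
  have -> : act_edges (lm_run E w r) != finset.set0 by apply/finset.set0Pn; exists e.
  rewrite ac; set b := (z < m) && _; by case: b.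
move=> s3 [[d3 f3 g3] fl3].
have f4 a : a != rT -> a \in statics -> ints s3 a = base a.
  move=> nt ha; rewrite f3 ?st //; move: ha nt.
  by rewrite !inE; do 10?case/orP=> [/eqP->//|]; move/eqP->.
apply: bruns_setreg => //; split; last by rewrite /= fl3.
split=> //.
- move=> a ha; have [ea|ne] := eqVneq a rT; last by rewrite ints_store (negbTE ne); exact: f4.
  rewrite ea ints_store eqxx; apply: funext => k; have [->|k0] := eqVneq k 0; last by rewrite g3 ?st.
  by rewrite /= f4 // (prep_T P) (prep_T0 P).
- by rewrite /= f3.
- by move=> j; rewrite /= f3.
- by move=> j jm; rewrite /= f3 // ou.
Qed.

Let phase := Seq rounds_prog check_prog.
Let tphase := cmd_size phase * (L.+1 * (lg m).+1 + h.+1).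
Let wphase := cmd_size phase * (6 * N * (lg m).+1).

Lemma runs_phase r s : 0 < m ->
  (forall r', r <= r' < r + lg m -> {in [pred k | k < m] &, injective (rnd r')}) ->
  round_inv r s ->
  runs rnd phase s tphase wphase (fun s' => round_inv (r + lg m) s' /\
    ints s' rFlag 0 = (act_edges (lm_run E w (r + lg m)) != finset.set0)).
Proof.
move=> m0 inj ri.
have := runs_seq (runs_rounds m0 inj ri) (fun s1 i1 => runs_check i1).
move=> hr; apply: (runs_weaken hr) => //.
  rewrite /tphase /= !mulnDr !mulnDl; lia.
rewrite /wphase -[cmd_size phase]/(cmd_size rounds_prog + cmd_size check_prog) mulnDl leq_add2l.
by rewrite leq_mul2l leq_pmulr ?orbT.
Qed.

(** After [b] further phases round [K] is reached, where no hyperedge is active, so a set flag means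
    that phases are left. Thus no round from [K] on is ever executed, and distinct weights are
    needed only before. *)
Lemma runs_phases K b r s : 0 < m ->
  (forall r', r' < K -> {in [pred k | k < m] &, injective (rnd r')}) ->
  act_edges (lm_run E w K) = finset.set0 ->
  r + b * lg m = K -> round_inv r s ->
  (ints s rFlag 0 = 0 /\ act_edges (lm_run E w r) = finset.set0) \/
  (ints s rFlag 0 != 0 /\ 0 < b) ->
  let g := (expr_size (Reg rFlag)).+1 in
  runs rnd (While (Reg rFlag) phase) s (g + b * (g + tphase)) (g + b * (g + wphase))
   (fun s' => exists r', act_edges (lm_run E w r') = finset.set0 /\ round_inv r' s').
Proof.
move=> m0 inj aK; elim: b r s => [|b IH] r s rK ri hf g.
  case: hf => [[f0 a0]|[_ //]]; exists s, g, g; split=> //; try lia.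
    exact: (@ExecWhileFalse _ rnd (Reg rFlag) phase s f0).
  by exists r.
case: hf => [[f0 a0]|[fn _]].
  exists s, g, g; split; [exact: (@ExecWhileFalse _ rnd (Reg rFlag) phase s f0)|lia|lia|by exists r].
have inj' r' : r <= r' < r + lg m -> {in [pred k | k < m] &, injective (rnd r')}.
  by move=> hr; apply: inj; move: rK; rewrite mulSn; lia.
have [s1 [t1 [w1 [e1 ht hw [ri1 fl1]]]]] := runs_phase m0 inj' ri.
have rK1 : r + lg m + b * lg m = K by rewrite -rK mulSn addnA.
have hf1 : (ints s1 rFlag 0 = 0 /\ act_edges (lm_run E w (r + lg m)) = finset.set0) \/
  (ints s1 rFlag 0 != 0 /\ 0 < b).
  rewrite fl1; case: eqP => [->|ne]; [by left|right; split=> //].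
  by rewrite lt0n; apply/eqP => b0; apply: ne; move: rK1; rewrite b0 addn0 => ->.
have [s2 [t2 [w2 [e2 ht2 hw2 q2]]]] := IH _ _ rK1 ri1 hf1.
exists s2, (g + t1 + t2), (g + w1 + w2); split=> //.
- exact: (@ExecWhileTrue _ rnd (Reg rFlag) phase _ _ _ _ _ _ _ fn e1 e2).
- by rewrite mulSn; lia.
- by rewrite mulSn; lia.
Qed.
End Loop.
End MainLoop.

(** * Counting weight functions *)

Section MaxCount.
Variables (I : finType) (N : nat).
Local Notation T := {ffun I -> 'I_N}.

Definition inj_weights : {set T} := [set f : T | injectiveb f].

Definition max_at (A : {set I}) (i : I) : {set T} :=
  [set f in inj_weights | [forall x in A, f x <= f i]].

(** Exchanging the weights of [i] and [j] is an injection from one set into the other. *)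
Lemma max_at_swap (A : {set I}) i j : i \in A -> j \in A -> #|max_at A i| <= #|max_at A j|.
Proof.
move=> iA jA; pose F (f : T) : T := [ffun x => f (tperm i j x)].
have Finj : injective F.
  move=> f g /ffunP h; apply/ffunP => x; have := h (tperm i j x).
  by rewrite !ffunE tpermK.
rewrite -(card_imset _ Finj); apply: subset_leq_card; apply/fintype.subsetP => g /imsetP[f].
rewrite !inE => /andP[/injectiveP fi /forall_inP fm] ->.
apply/andP; split.
  by apply/injectiveP => x y; rewrite !ffunE => /fi /perm_inj.
apply/forall_inP => x xA; rewrite !ffunE tpermR; apply: fm.
by case: tpermP => [_|_|].
Qed.

(** By symmetry each element of [A] is equally often the largest, and an injective weight function
    has exactly one largest element in [A]. *)
Lemma card_max_at (A : {set I}) i : i \in A -> #|max_at A i| * #|A| = #|inj_weights|.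
Proof.
move=> iA; rewrite mulnC -sum_nat_const.
rewrite (eq_bigr (fun j => #|max_at A j|)) => [|j jA]; last first.
  by apply/eqP; rewrite eqn_leq !max_at_swap.
rewrite -sum1_card; under eq_bigr do rewrite -sum1_card.
rewrite (exchange_big_dep (mem inj_weights)) /=; last by move=> j f _; rewrite inE => /andP[].
apply: eq_bigr => f fi.
case: (@arg_maxnP _ i (mem A) (fun j => f j) iA) => j jA jm.
rewrite (big_pred1 j) // => k /=; apply/andP/eqP => [[kA]|->].
  rewrite inE => /andP[_ /forall_inP km].
  move: fi; rewrite inE => /injectiveP; apply; apply/val_inj/eqP.
  by rewrite eqn_leq (km j jA) andbT; apply: jm.
by split=> //; rewrite inE fi; apply/forall_inP => x xA; apply: jm.
Qed.

(** A union bound over pairs. For a fixed pair, a function with equal values at [i] and [j] and a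
    further number can be coded as one function by overwriting the value at [j], which is recovered
    from the value at [i]. *)
Lemma card_not_inj : #|~: inj_weights| * N <= #|I| * #|I| * #|{: T}|.
Proof.
have pr (i j : I) : i != j -> #|[set f : T | f i == f j]| * N <= #|{: T}|.
  move=> ij; have -> : #|[set f : T | f i == f j]| * N =
      #|finset.setX [set f : T | f i == f j] [set: 'I_N]|.
    by rewrite cardsX cardsT card_ord.
  pose F (p : T * 'I_N) : T := [ffun x => if x == j then p.2 else p.1 x].
  apply: (leq_card_in F) => -[f k] [g l].
  rewrite !inE /= !andbT => /eqP fi /eqP gi /ffunP h.
  have hj := h j; rewrite !ffunE eqxx /= in hj.
  have hi := h i; rewrite !ffunE (negbTE ij) /= in hi.
  congr (_, _) => //; apply/ffunP => x; have := h x; rewrite !ffunE /=.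
  by case: eqP => [->|//]; rewrite -fi -gi.
have sub : ~: inj_weights \subset \bigcup_(p : I * I | p.1 != p.2) [set f : T | f p.1 == f p.2].
  apply/fintype.subsetP => f; rewrite !inE => /injectivePn[i [j ij fij]].
  by apply/finset.bigcupP; exists (i, j) => //; rewrite inE fij.
apply: (@leq_trans (\sum_(p : I * I | p.1 != p.2) #|[set f : T | f p.1 == f p.2]| * N)).
  rewrite -big_distrl leq_mul2r; apply/orP; right.
  apply: leq_trans (subset_leq_card sub) _.
  elim/big_rec2: _ => [|p a A _ h]; first by rewrite cards0.
  by rewrite (leq_trans (leq_card_setU _ _)) // leq_add2l.
apply: (@leq_trans (\sum_(p : I * I) #|{: T}|)); last by rewrite sum_nat_const card_prod.
rewrite big_mkcond; apply: leq_sum => p _; case: ifP => // h; exact: pr.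
Qed.
End MaxCount.

(** * The potential halves on average *)

Section Potential.
Variables (R : realType) (V : finType) (E : {set {set V}}) (N : nat).
Hypothesis E0 : finset.set0 \notin E.
Local Notation T := {ffun {set V} -> 'I_N}.
Implicit Types (S : lm_state V) (f : T).

Definition wt f (e : {set V}) : R := ((f e : nat)%:R)%R.

Definition adjacent S (e : {set V}) : {set {set V}} :=
  [set g in act_edges S | ~~ [disjoint e & g]].

Definition potential S : nat := \sum_(e in act_edges S) #|adjacent S e|.

Lemma adjacent_sym S e g : e \in act_edges S -> g \in act_edges S ->
  (g \in adjacent S e) = (e \in adjacent S g).
Proof. by move=> ea ga; rewrite !inE ea ga disjoint_sym. Qed.

Lemma adjacent_self S e : lm_wf E S -> e \in act_edges S -> e \in adjacent S e.
Proof.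
move=> wf ea; rewrite inE ea -finset.setI_eq0 finset.setIid.
by apply: contraNneq E0 => <-; apply: (fintype.subsetP wf.1).
Qed.

Lemma local_max_new S f e : lm_wf E S -> injective f -> e \in act_edges S ->
  (forall x, x \in adjacent S e -> f x <= f e) -> e \in lm_new (wt f) S.
Proof.
move=> wf fi ea mx; rewrite inE ea; apply/forall_inP => v ve.
rewrite /selection (fintype.subsetP (wf.2 _ ea)) //; apply/eqP.
have mx' x : x \in act_edges S -> v \in x -> f x <= f e.
  move=> xa vx; apply: mx; rewrite inE xa; apply/pred0Pn; exists v.
  by rewrite /= ve vx.
case: pickP => [x /and3P[xa vx /forallP h]|/(_ e)].
  congr Some; apply: fi; apply/val_inj/eqP; rewrite eqn_leq mx' //=.
  by have := h e; rewrite ea ve /= ler_nat.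
rewrite ea ve /= => /negbT /forallPn[x]; rewrite !negb_imply => /and3P[xa vx].
by rewrite ler_nat mx'.
Qed.

(* Call [e] preempting [g] if [e] meets [g] and has the largest weight among all hyperedges
   meeting [e] or [g]. Then [e] gets matched and [g] inactive, no other hyperedge preempts
   [g], and the event has probability at least 1 / (D e + D g), where D is the number of
   active neighbours. Summing D g over all pairs and symmetrizing gives half the potential. *)
Lemma potential_round S : lm_wf E S ->
  2 * (\sum_(f in inj_weights {set V} N) potential (lm_round (wt f) S)) <=
  #|inj_weights {set V} N| * potential S.
Proof.
move=> wf; set W := inj_weights _ _; pose act := act_edges S.
pose U e g := adjacent S e :|: adjacent S g.
pose c e g := #|max_at N (U e g) e|.
have eU e g : e \in act -> e \in U e g by move=> ea; rewrite inE adjacent_self.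
have cE e g : e \in act -> c e g * #|U e g| = #|W| by move=> ea; apply: card_max_at; apply: eU.
(* Both counts equal the number of injective weight functions divided by the size of the same
   union. *)
have csym e g : e \in act -> g \in act -> c e g = c g e.
  move=> ea ga; have := cE _ g ea; have := cE _ e ga.
  rewrite /U [in X in _ * #|X| = _ -> _]finset.setUC -/(U e g) => <- /eqP.
  rewrite eqn_pmul2r; first by move/eqP.
  by apply/card_gt0P; exists e; apply: eU.
have round1 f : f \in W ->
    potential (lm_round (wt f) S) +
    \sum_(g in act) \sum_(e in adjacent S g) #|adjacent S g| * (f \in max_at N (U e g) e) <= potential S.
  move=> fW; have fi : injective f by move: fW; rewrite inE => /injectiveP.
  set S' := lm_round _ S.
  have act' e : (e \in act_edges S') = (e \in act) && [disjoint e & finset.cover (lm_new (wt f) S)].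
    by rewrite /S' lm_roundE inE.
  apply: (@leq_trans (\sum_(g in act) (#|adjacent S g| * (g \in act_edges S') +
      \sum_(e in adjacent S g) #|adjacent S g| * (f \in max_at N (U e g) e)))).
    rewrite big_split leq_add2r /potential big_mkcond [X in _ <= X]big_mkcond.
    apply: leq_sum => g _; case: ifP => [ga'|_]; last by case: ifP.
    have ga : g \in act by move: ga'; rewrite act' => /andP[].
    rewrite ga muln1; apply: subset_leq_card; apply/fintype.subsetP => x.
    by rewrite [x \in adjacent S' g]inE [x \in adjacent S g]inE => /andP[+ ->]; rewrite act' => /andP[-> _].
  apply: leq_sum => g ga; rewrite -big_distrr -mulnDr -[X in _ <= X]muln1 leq_mul2l.
  apply/orP; right.
  have pre e : e \in adjacent S g -> f \in max_at N (U e g) e -> e \in lm_new (wt f) S.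
    move=> eg; rewrite inE => /andP[_ /forall_inP mx].
    apply: local_max_new => // [|x xe]; first by move: eg; rewrite inE => /andP[].
    by apply: mx; rewrite inE xe.
  have un e e' : e \in adjacent S g -> e' \in adjacent S g -> f \in max_at N (U e g) e ->
      f \in max_at N (U e' g) e' -> e = e'.
    move=> eg eg'; rewrite !inE => /andP[_ /forall_inP m1] /andP[_ /forall_inP m2].
    apply: fi; apply/val_inj/eqP; rewrite eqn_leq m2 ?m1 //; rewrite inE ?eg ?eg' orbT //.
  case: (pickP (fun e => (e \in adjacent S g) && (f \in max_at N (U e g) e))) => [e /andP[eg fe]|none].
    have -> : (g \in act_edges S') = false.
      rewrite act' ga /=; apply/negbTE; have en := pre _ eg fe.
      move: eg; rewrite inE => /andP[_]; apply: contra => d.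
      by apply: disjointWr d; apply: finset.bigcup_sup.
    rewrite add0n (bigD1 e) //= fe big1 // => e' /andP[eg' ne].
    by apply/eqP; rewrite eqb0; apply: contra ne => fe'; rewrite (un e' e).
  rewrite big1 ?addn0 ?leq_b1 // => e eg; apply/eqP; rewrite eqb0.
  by have := none e; rewrite eg /= => ->.
have sum1 : \sum_(f in W) potential (lm_round (wt f) S) +
    \sum_(g in act) \sum_(e in adjacent S g) #|adjacent S g| * c e g <= #|W| * potential S.
  have -> : \sum_(g in act) \sum_(e in adjacent S g) #|adjacent S g| * c e g =
     \sum_(f in W) \sum_(g in act) \sum_(e in adjacent S g) #|adjacent S g| * (f \in max_at N (U e g) e).
    rewrite exchange_big; apply: eq_bigr => g ga; rewrite exchange_big.
    apply: eq_bigr => e eg; rewrite -big_distrr /=; congr (_ * _).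
    rewrite /c -sum1_card big_mkcond [RHS]big_mkcond; apply: eq_bigr => f _.
    by case: (boolP (f \in max_at _ _ _)) => [|_]; rewrite ?if_same // inE => /andP[-> _].
  by rewrite -big_split -sum_nat_const; apply: leq_sum.
(* By the symmetry of [c] the factor of [g] may be replaced by that of [e]. The two versions
   together give each pair at least [c e g * #|U e g|], which is [#|W|], and the number of pairs is
   [potential S]. *)
have sum2 : #|W| * potential S <= 2 * (\sum_(g in act) \sum_(e in adjacent S g) #|adjacent S g| * c e g).
  have inA g e : e \in adjacent S g -> e \in act by rewrite inE => /andP[].
  have ex : \sum_(g in act) \sum_(e in adjacent S g) #|adjacent S g| * c e g =
      \sum_(g in act) \sum_(e in adjacent S g) #|adjacent S e| * c e g.
    rewrite (exchange_big_dep (mem act)) /=; last by move=> g e _ /inA.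
    apply: eq_bigr => e ea; apply: eq_big => [g|g /andP[ga ge]].
      apply/andP/idP => [[ga]|ge]; first by rewrite adjacent_sym.
      by rewrite (inA _ _ ge) adjacent_sym // (inA _ _ ge).
    by rewrite csym.
  rewrite mul2n -addnn {2}ex -big_split /= /potential big_distrr /=.
  apply: leq_sum => g ga; rewrite -big_split /= mulnC -sum_nat_const.
  apply: leq_sum => e eg; rewrite -mulnDl -(cE e g (inA _ _ eg)) mulnC leq_mul2r.
  by rewrite addnC leq_card_setU orbT.
move: sum1 sum2; lia.
Qed.
End Potential.

Lemma big_tuple_cons (T : finType) K (P : pred (K.+1.-tuple T)) (F : K.+1.-tuple T -> nat) :
  \sum_(t | P t) F t =
  \sum_f \sum_(t : K.-tuple T | P [tuple of f :: t]) F [tuple of f :: t].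
Proof.
rewrite pair_big_dep (reindex (fun p : T * K.-tuple T => [tuple of p.1 :: p.2])) /=.
  by apply: eq_bigl => -[f t].
exists (fun t => (thead t, [tuple of behead t])) => [[f t] _|t _] /=.
  by congr (_, _); apply/val_inj.
by rewrite -tuple_eta.
Qed.

(** * Many rounds and the number of failing weight sequences *)

Section Iterate.
Variables (R : realType) (V : finType) (E : {set {set V}}) (N : nat).
Hypothesis E0 : finset.set0 \notin E.
Local Notation T := {ffun {set V} -> 'I_N}.
Local Notation W := (inj_weights {set V} N).

Definition lm_runs (S : lm_state V) (l : seq T) : lm_state V :=
  foldl (fun S f => lm_round (wt R f) S) S l.

(** Independence of the rounds in counting form: the first round is split off, and the induction
    hypothesis is used for each state it can lead to. *)
Lemma potential_runs K (S : lm_state V) : lm_wf E S ->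
  2 ^ K * (\sum_(t : K.-tuple T | all (mem W) t) potential (lm_runs S t)) <=
  #|W| ^ K * potential S.
Proof.
elim: K S => [|K IH] S wf.
  rewrite !expn0 !mul1n (big_pred1 [tuple]) // => t.
  by rewrite [t]tuple0 /= eqxx.
rewrite big_tuple_cons /= expnSr -mulnA big_distrr /=.
have h f : \sum_(t : K.-tuple T | (f \in W) && all (mem W) t) potential (lm_runs (lm_round (wt R f) S) t) =
  if f \in W then \sum_(t : K.-tuple T | all (mem W) t) potential (lm_runs (lm_round (wt R f) S) t) else 0.
  by case: (f \in W) => //=; rewrite big_pred0_eq.
under eq_bigr do rewrite h.
rewrite -big_distrr -big_mkcond mulnCA /=.
apply: (@leq_trans (2 * (\sum_(f in W) #|W| ^ K * potential (lm_round (wt R f) S)))).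
  rewrite leq_mul2l /= big_distrr; apply: leq_sum => f _.
  by apply: IH; apply: lm_wf_round.
rewrite -big_distrr mulnCA /= expnSr -mulnA leq_mul2l.
by rewrite (potential_round R N E0 wf) ?orbT.
Qed.

Lemma card_not_all K :
  #|[set t : K.-tuple T | ~~ all (mem W) t]| * N <=
  K * (#|{: {set V}}| * #|{: {set V}}|) * #|{: T}| ^ K.
Proof.
set s2 := #|{: {set V}}| * _.
elim: K => [|K IH].
  rewrite -sum1_card (eq_bigl pred0) ?big_pred0_eq // => t.
  by rewrite inE [t]tuple0.
rewrite -sum1_card (eq_bigl (fun t : K.+1.-tuple T => ~~ all (mem W) t)); last first.
  by move=> t; rewrite inE.
rewrite big_tuple_cons /=.
have h f : \sum_(t : K.-tuple T | ~~ ((f \in W) && all (mem W) t)) 1 <=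
    (f \in ~: W) * #|{: T}| ^ K + #|[set t : K.-tuple T | ~~ all (mem W) t]|.
  rewrite !inE; case: (injectiveb f) => /=.
    rewrite add0n -sum1_card.
    by rewrite leq_eqVlt; apply/orP; left; apply/eqP; apply: eq_bigl => t; rewrite inE.
  by rewrite mul1n sum1_card card_tuple leq_addr.
apply: (@leq_trans ((#|~: W| * #|{: T}| ^ K + #|{: T}| * #|[set t : K.-tuple T | ~~ all (mem W) t]|) * N)).
  rewrite leq_mul2r; apply/orP; right.
  apply: (@leq_trans (\sum_(f : T) ((f \in ~: W) * #|{: T}| ^ K +
     #|[set t : K.-tuple T | ~~ all (mem W) t]|))); first by apply: leq_sum => f _; apply: h.
  have cA (A : {set T}) : \sum_(f : T) (f \in A) = #|A|.
    by rewrite -sum1_card [RHS]big_mkcond; apply: eq_bigr => f _; case: (f \in A).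
  by rewrite big_split /= -big_distrl /= sum_nat_const cA.
have := card_not_inj {set V} N; rewrite -/s2.
move: IH; set u := #|_|; set tk := #|{: T}| ^ K; set ni := #|~: W|; rewrite expnS -/tk.
set tt := #|{: T}| => IH hn.
have h1 : ni * N * tk <= s2 * tt * tk by rewrite leq_mul2r hn orbT.
have h2 : tt * (u * N) <= tt * (K * s2 * tk) by rewrite leq_mul2l IH orbT.
have -> : (ni * tk + tt * u) * N = ni * N * tk + tt * (u * N) by ring.
have -> : K.+1 * s2 * (tt * tk) = s2 * tt * tk + tt * (K * s2 * tk) by ring.
exact: leq_add.
Qed.

(** A tie counts as failure even if the rounded run ends well, because the rounded weights then no
    longer determine the run on the real weights. *)
Definition failing K : {set K.-tuple T} :=
  [set t : K.-tuple T | ~~ (all (mem W) t &&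
     (act_edges (lm_runs (LMState finset.setT E finset.set0) t) == finset.set0))].

(** The assumption on [N] makes ties, and the one on [K] makes surviving hyperedges, at most a
    fraction [1 / (2 M)] each. *)
Lemma card_failing K M : 0 < K -> E != finset.set0 ->
  2 * (K * (#|{: {set V}}| * #|{: {set V}}|)) * M <= N ->
  2 * (#|E| * #|E|) * M <= 2 ^ K ->
  M * #|failing K| <= #|{: T}| ^ K.
Proof.
move=> K0 En0 hN hK; pose S0 : lm_state V := LMState finset.setT E finset.set0.
have m0 : 0 < #|E| by rewrite card_gt0.
have s0 : 0 < #|{: {set V}}| by apply/card_gt0P; exists finset.set0.
set b1 := #|[set t : K.-tuple T | ~~ all (mem W) t]|.
pose b2 := #|[set t : K.-tuple T | all (mem W) t && (act_edges (lm_runs S0 t) != finset.set0)]|.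
have hb : #|failing K| <= b1 + b2.
  apply: leq_trans (subset_leq_card _) (leq_card_setU _ _).
  apply/fintype.subsetP => t; rewrite !inE negb_and.
  by case: (all _ _).
have pot0 : potential S0 <= #|E| * #|E|.
  rewrite /potential -sum_nat_const; apply: leq_sum => e _.
  by apply: subset_leq_card; apply/fintype.subsetP => g; rewrite inE => /andP[].
have hb2 : b2 * 2 ^ K <= #|{: T}| ^ K * (#|E| * #|E|).
  have := potential_runs K (lm_wf0 E); rewrite -/S0 => h.
  apply: leq_trans (leq_trans h _); last first.
    apply: leq_mul => //; rewrite leq_exp2r //; exact: max_card.
  rewrite mulnC leq_mul2l; apply/orP; right; rewrite /b2 -sum1_card.
  rewrite (eq_bigl (fun t : K.-tuple T => all (mem W) t && (act_edges (lm_runs S0 t) != finset.set0))); last first.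
    by move=> t; rewrite inE.
  (* The Markov inequality: a surviving hyperedge is adjacent to itself, so the potential is at
     least 1. *)
  rewrite big_mkcondr; apply: leq_sum => t _; case: ifP => // /finset.set0Pn[e ea].
  rewrite /potential (bigD1 e) //=; apply: leq_trans (leq_addr _ _).
  apply/card_gt0P; exists e; apply: (adjacent_self E0) ea.
  by move: (t : seq T) => l; elim/last_ind: l => [|l f IH]; rewrite /lm_runs ?foldl_rcons;
    [exact: lm_wf0|exact: lm_wf_round].
have hb1 := card_not_all K; rewrite -/b1 in hb1.
set O := #|{: T}| ^ K in hb1 hb2 *.
set X := K * _ in hb1 hN; have X0 : 0 < X by rewrite !muln_gt0 K0 s0.
set Y := #|E| * #|E| in hb2 hK; have Y0 : 0 < Y by rewrite muln_gt0 m0.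
have c1 : 2 * M * b1 <= O.
  rewrite -(leq_pmul2r X0) (mulnC O X); apply: leq_trans hb1.
  have -> : 2 * M * b1 * X = b1 * (2 * X * M) by ring.
  by rewrite leq_mul2l hN orbT.
have c2 : 2 * M * b2 <= O.
  rewrite -(leq_pmul2r Y0); apply: leq_trans hb2.
  have -> : 2 * M * b2 * Y = b2 * (2 * Y * M) by ring.
  by rewrite leq_mul2l hK orbT.
have : M * #|failing K| <= M * (b1 + b2) by rewrite leq_mul2l hb orbT.
move=> h; apply: leq_trans h _.
by rewrite -(leq_pmul2l (isT : 0 < 2)) mulnA mulnDr; lia.
Qed.

End Iterate.

Section Compare.
Variables (R : realType) (V : finType) (E : {set {set V}}).

(** A round uses the weights only through comparisons of active hyperedges. *)
Lemma eq_lm_round (w w' : {set V} -> R) (S : lm_state V) :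
  (forall e e', e \in act_edges S -> e' \in act_edges S -> (w e <= w e')%R = (w' e <= w' e')%R) ->
  lm_round w S = lm_round w' S.
Proof.
move=> h; have sE v : selection S w v = selection S w' v.
  rewrite /selection; case: ifP => // _; apply: eq_pick => e.
  case ea : (e \in act_edges S) => //=; congr (_ && _); apply: eq_forallb => e'.
  by case e'a : (e' \in act_edges S) => //=; rewrite h.
have nE : lm_new w S = lm_new w' S.
  apply/finset.setP => e; rewrite !inE; congr (_ && _); apply: eq_forallb => v.
  by rewrite sE.
by rewrite !lm_roundE nE.
Qed.

Lemma eq_lm_run (w w' : nat -> {set V} -> R) K :
  (forall r e e', r < K -> e \in E -> e' \in E -> (w r e <= w r e')%R = (w' r e <= w' r e')%R) ->
  lm_run E w K = lm_run E w' K.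
Proof.
elim: K => [//|K IH] h /=; rewrite IH => [|r e e' rK]; last by apply: h; apply: ltnW.
have sub := fintype.subsetP (lm_wf_run E w' K).1.
by apply: eq_lm_round => e e' /sub eE /sub eE'; apply: h.
Qed.

Lemma lm_run_runs N (f0 : {ffun {set V} -> 'I_N}) (l : seq {ffun {set V} -> 'I_N}) r :
  r <= size l ->
  lm_run E (fun r => wt R (nth f0 l r)) r =
  lm_runs R (LMState finset.setT E finset.set0) (take r l).
Proof.
elim: r => [|r IH] rl /=; first by rewrite take0.
by rewrite IH 1?ltnW // (take_nth f0 rl) /lm_runs foldl_rcons.
Qed.
End Compare.

(** * Rounded weights *)

Section Cells.
Local Open Scope classical_set_scope.
Local Open Scope ring_scope.

Lemma uniform_prob_itv (R : realType) (a b : R) : 0 <= a -> a <= b -> b <= 1 ->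
  uniform_prob (@ltr01 R) `[a, b[%classic = (b - a)%:E.
Proof.
move=> a0 ab b1; rewrite /uniform_prob.
rewrite (eq_integral (fun=> 1%E)); last first.
  move=> x; rewrite inE /= in_itv /= => /andP[ax xb].
  by rewrite /uniform_pdf (le_trans a0 ax) (le_trans (ltW xb) b1) subr0 invr1.
rewrite integral_cst //= mul1e lebesgue_measure_itv /= lte_fin.
have [ltab|leba] := ltP a b; first by rewrite EFinB.
by rewrite (_ : b = a) ?subrr //; apply/eqP; rewrite eq_le leba ab.
Qed.

Variables (R : realType) (dsp : measure_display) (T : measurableType dsp).
Variables (P : probability T R) (U : nat * nat -> {RV P >-> R}).
Hypotheses (indU : mutually_independent U) (unifU : forall i, uniform01 (U i)).
Variables (I : finType) (num : I -> nat) (N' K : nat).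
Hypothesis num_inj : injective num.
Let N := N'.+1.
Local Notation F := {ffun I -> 'I_N}.

Definition slot (k : nat) : set R := `[k%:R / N%:R, k.+1%:R / N%:R[.

Lemma slot_inj k l y : slot k y -> slot l y -> k = l.
Proof.
have N0 : (0 < N%:R :> R) by rewrite ltr0n.
rewrite /slot /= !in_itv /= !ler_pdivrMr // !ltr_pdivlMr //.
move=> /andP[h1 h2] /andP[h3 h4]; apply/eqP; rewrite eqn_leq.
by apply/andP; split; rewrite -ltnS -(ltr_nat R); [apply: le_lt_trans h4|apply: le_lt_trans h2].
Qed.

(** Independence is stated for families of sets over all indices, hence the default [setT] where
    [num] takes no value. *)
Definition cell_set (t : K.-tuple F) (i : nat * nat) : set R :=
  if [pick e | num e == i.2] is Some e then slot (nth [ffun=> ord0] t i.1 e) else setT.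

Definition cell_idx : seq (nat * nat) := [seq (r, num e) | r <- iota 0 K, e <- enum I].

Definition cell (t : K.-tuple F) : set T :=
  \big[setI/setT]_(i <- cell_idx) (U i @^-1` cell_set t i).

Lemma cell_setE t r e : cell_set t (r, num e) = slot (nth [ffun=> ord0] t r e).
Proof.
rewrite /cell_set; case: pickP => [e' /eqP /num_inj -> //|/(_ e)].
by rewrite /= eqxx.
Qed.

Lemma measurable_cell_set t i : measurable (cell_set t i).
Proof. by rewrite /cell_set; case: pickP => // e _; exact: measurable_itv. Qed.

Lemma measurable_cell t : measurable (cell t).
Proof.
apply: bigsetI_measurable => i _.
have := measurable_funP (U i) measurableT _ (measurable_cell_set t i).
by rewrite setTI.
Qed.

Lemma cellP t x r e : cell t x -> (r < K)%N -> slot (nth [ffun=> ord0] t r e) (U (r, num e) x).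
Proof.
move=> ct rK; rewrite -cell_setE.
have : (r, num e) \in cell_idx.
  by apply/allpairsP; exists (r, e); rewrite mem_iota rK mem_enum.
by move: ct; rewrite /cell -bigcap_seq => /[swap] h /(_ (r, num e) h).
Qed.

Lemma cell_inj t t' x : cell t x -> cell t' x -> t = t'.
Proof.
move=> ct ct'; apply: eq_from_tnth => r; apply/ffunP => e.
rewrite !(tnth_nth [ffun=> ord0]); apply/val_inj.
exact: slot_inj (cellP e ct (ltn_ord r)) (cellP e ct' (ltn_ord r)).
Qed.

Lemma prob_cell t : P (cell t) = ((N%:R^-1) ^+ (K * #|I|))%:E.
Proof.
have uq : uniq cell_idx.
  apply: allpairs_uniq; [exact: iota_uniq|exact: enum_uniq|].
  by move=> [r e] [r' e'] _ _ [-> /num_inj ->].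
rewrite /cell indU //; last exact: measurable_cell_set.
have sz : size cell_idx = (K * #|I|)%N by rewrite size_allpairs size_iota cardE.
have N0 : (0 < N%:R :> R) by rewrite ltr0n.
rewrite -sz (eq_big_seq (fun=> (N%:R^-1)%:E)).
  by elim: cell_idx {uq sz} => [|i l IH]; rewrite ?big_nil // big_cons IH exprS EFinM.
move=> _ /allpairsP[[r e] [_ _ ->]] /=; rewrite cell_setE.
case: (nth [ffun=> ord0] t r e) => k kN /=.
have := unifU (r, num e) (measurable_itv `[k%:R / N%:R, k.+1%:R / N%:R[).
rewrite uniform_prob_itv.
- rewrite /distribution /pushforward => ->; congr EFin.
  by rewrite -mulrBl -natrB // subSnn mul1r.
- by rewrite divr_ge0.
- by rewrite ler_pM2r ?invr_gt0 // ler_nat.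
- by rewrite ler_pdivrMr // mul1r ler_nat.
Qed.

(** The cells are disjoint boxes of equal probability, so a probability becomes a proportion of
    weight sequences. *)
Lemma prob_cells (G : {set K.-tuple F}) (A := \bigcup_(t in [set` enum G]) cell t) :
  measurable A /\ P A = (#|G|%:R / N%:R ^+ (K * #|I|))%:E.
Proof.
have finG : finite_set [set` enum G] by exact: finite_seq.
split; first by apply: fin_bigcup_measurable => // t _; exact: measurable_cell.
rewrite measure_fin_bigcup //.
- rewrite -fsbig_seq ?enum_uniq //.
  rewrite (eq_bigr (fun=> ((N%:R^-1) ^+ (K * #|I|))%:E)) => [|t _]; last exact: prob_cell.
  by rewrite sumEFin big_const_seq count_predT -cardE iter_addr addr0 exprVn mulr_natl.
- by move=> t t' _ _ [x [ct ct']]; apply: cell_inj ct ct'.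
- by move=> t _; exact: measurable_cell.
Qed.
End Cells.

(** * Adjacency arrays *)

Section AdjacencyArrays.
Variable rows : seq (seq nat).

Lemma foldl_addn a (s : seq nat) : foldl addn a s = a + sumn s.
Proof. by elim: s a => [|x s IH] a /=; rewrite ?addn0 // IH addnA. Qed.

Lemma nth_offsets i : i <= size rows ->
  nth 0 (offsets rows) i = sumn (take i (shape rows)).
Proof.
case: i => [|i] hi; first by rewrite take0.
by rewrite /offsets /= nth_scanl ?size_map // foldl_addn.
Qed.

Lemma offsetsS i : i < size rows ->
  nth 0 (offsets rows) i.+1 = nth 0 (offsets rows) i + size (nth [::] rows i).
Proof.
move=> hi; rewrite (nth_offsets hi) (nth_offsets (ltnW hi)) (take_nth 0) ?size_map //.
by rewrite sumn_rcons (nth_map [::]).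
Qed.

Lemma nth_flatten_row i x : i < size rows ->
  nth 0 (offsets rows) i <= x < nth 0 (offsets rows) i.+1 ->
  nth 0 (flatten rows) x = nth 0 (nth [::] rows i) (x - nth 0 (offsets rows) i) /\
  x - nth 0 (offsets rows) i < size (nth [::] rows i).
Proof.
move=> hi; rewrite offsetsS // => hx.
have hc : x - nth 0 (offsets rows) i < size (nth [::] rows i) by lia.
split=> //; set c := x - _ in hc *.
have hc' : c < nth 0 (shape rows) i by rewrite (nth_map [::]).
have -> : x = flatten_index (shape rows) i c.
  by rewrite /flatten_index -(nth_offsets (ltnW hi)) /c subnKC //; case/andP: hx.
by rewrite nth_flatten flatten_indexKl // flatten_indexKr.
Qed.

Lemma csr_rows (inc : nat -> nat -> bool) :
  (forall i, i < size rows -> 0 < size (nth [::] rows i)) ->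
  (forall i j, i < size rows -> (j \in nth [::] rows i) = inc i j) ->
  csr (size rows) (size (flatten rows)) (nth 0 (offsets rows)) (nth 0 (flatten rows)) inc.
Proof.
move=> ne incE; split=> //.
- by rewrite nth_offsets // take_oversize ?size_map // size_flatten.
- by move=> i hi; rewrite offsetsS // -addn1 leq_add2l ne.
- move=> i x hi hx; have [-> hc] := nth_flatten_row hi hx.
  by rewrite -incE // mem_nth.
- move=> i j hi; rewrite -incE // => hj.
  have hx : nth 0 (offsets rows) i <= nth 0 (offsets rows) i + index j (nth [::] rows i)
      < nth 0 (offsets rows) i.+1.
    by rewrite leq_addr offsetsS // ltn_add2l index_mem.
  exists (nth 0 (offsets rows) i + index j (nth [::] rows i)) => //.
  by have [-> _] := nth_flatten_row hi hx; rewrite addKn nth_index.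
Qed.

Lemma size_flatten_rows (X : eqType) (xs : seq X) (f : X -> nat) :
  uniq xs -> size rows = size xs ->
  (forall x, x \in xs -> size (nth [::] rows (index x xs)) = f x) ->
  size (flatten rows) = \sum_(x <- xs) f x.
Proof.
move=> un sz hf; rewrite size_flatten sumnE.
have -> : shape rows = [seq f x | x <- xs].
  case: xs un sz hf => [|x0 xs'] un sz hf; first by move/size0nil: sz => ->.
  apply: (@eq_from_nth _ 0); rewrite ?size_map // => i hi.
  have hi' : i < size (x0 :: xs') by rewrite -sz.
  rewrite (nth_map [::]) // (nth_map x0) // -hf ?mem_nth //.
  by rewrite index_uniq.
by rewrite big_map.
Qed.
End AdjacencyArrays.

(** * The input arrays and bounds by kappa *)

Section Represents.
Variables (V : finType) (E : {set {set V}}).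
Variables (vs : seq V) (es : seq {set V}) (vrows erows : seq (seq nat)).
Hypotheses (E0 : finset.set0 \notin E) (dpos : forall v : V, 0 < deg E v).
Hypothesis Rep : represents E vs es vrows erows.
Local Notation inc := (incidence E vs es).

Lemma repPvs : perm_eq vs (enum V). Proof. by case: Rep => -[]. Qed.
Lemma repPes : perm_eq es (enum E). Proof. by case: Rep => -[]. Qed.
Lemma size_vrows : size vrows = #|V|. Proof. by case: Rep. Qed.
Lemma size_erows : size erows = #|E|. Proof. by case: Rep. Qed.

Lemma mem_vrow i j : i < size vrows -> (j \in nth [::] vrows i) = inc i j.
Proof.
rewrite size_vrows => ni; have [v <-] := ex_vertex repPvs ni.
case: (Rep) => _ _ _ /(_ v) h _; rewrite (perm_mem h).
apply/mapP/idP => [[e]|].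
  by rewrite mem_filter mem_enum => /andP[ve eE] ->; rewrite (incidenceE repPvs repPes).
move=> hi; have /andP[_ jm] := incidence_lt repPvs hi.
exists (nthe es j); last by rewrite (index_nthe repPes).
have eE := nthe_in repPes jm; rewrite mem_filter mem_enum eE andbT.
by rewrite -(incidenceE repPvs repPes) ?(index_nthe repPes).
Qed.

Lemma mem_erow j i : j < size erows -> (i \in nth [::] erows j) = inc i j.
Proof.
rewrite size_erows => jm; have eE := nthe_in repPes jm.
case: (Rep) => _ _ _ _ /(_ _ eE) h; rewrite -(index_nthe repPes jm) (perm_mem h).
apply/mapP/idP => [[v]|hi].
  by rewrite mem_enum => ve ->; rewrite (incidenceE repPvs repPes).
have /andP[ni _] := incidence_lt repPvs hi; have [v ev] := ex_vertex repPvs ni.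
by exists v; rewrite ?mem_enum -?ev // -(incidenceE repPvs repPes) // ev.
Qed.

Lemma size_vrow v : size (nth [::] vrows (index v vs)) = deg E v.
Proof.
case: Rep => _ _ _ h _; rewrite (perm_size (h v)) size_map /deg cardE.
apply/perm_size/uniq_perm; [exact/filter_uniq/enum_uniq|exact: enum_uniq|move=> e].
by rewrite mem_filter !mem_enum inE andbC.
Qed.

Lemma size_erow e : e \in E -> size (nth [::] erows (index e es)) = #|e|.
Proof.
by move=> eE; case: Rep => _ _ _ _ /(_ e eE) h; rewrite (perm_size h) size_map -cardE.
Qed.

Lemma kappaE : kappa E = \sum_(e in E) #|e|.
Proof.
rewrite /kappa; under eq_bigr do rewrite /deg -sum1_card.
rewrite (exchange_big_dep (mem E)) /=; last by move=> v e _; rewrite inE => /andP[].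
apply: eq_bigr => e eE; rewrite -sum1_card; apply: eq_bigl => v.
by rewrite inE eE.
Qed.

Lemma size_flatten_vrows : size (flatten vrows) = kappa E.
Proof.
rewrite (@size_flatten_rows _ _ vs (deg E)) ?size_vrows ?(size_vs repPvs) //.
- by rewrite (perm_big _ repPvs) big_enum.
- by rewrite (perm_uniq repPvs) enum_uniq.
- by move=> v _; apply: size_vrow.
Qed.

Lemma size_flatten_erows : size (flatten erows) = kappa E.
Proof.
rewrite (@size_flatten_rows _ _ es (fun e : {set V} => #|e|)) ?size_erows ?(size_es repPes) //.
- by rewrite (perm_big _ repPes) big_enum kappaE.
- exact: uniq_es repPes.
- by move=> e; rewrite (mem_es repPes) => eE; apply: size_erow.
Qed.

Lemma vrow_bounds i : i < #|V| ->
  0 < size (nth [::] vrows i) <= max_deg E.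
Proof.
move=> ni; have [v <-] := ex_vertex repPvs ni.
by rewrite size_vrow dpos; apply: (leq_bigmax_cond (F := deg E)).
Qed.

Lemma erow_bounds j : j < #|E| -> 0 < size (nth [::] erows j) <= rank E.
Proof.
move=> jm; have eE := nthe_in repPes jm.
rewrite -(index_nthe repPes jm) size_erow // card_gt0; apply/andP; split.
  by apply: contraNneq E0 => <-.
exact: (leq_bigmax_cond (F := fun e : {set V} => #|e|)).
Qed.

Lemma card_V_le : #|V| <= kappa E.
Proof. by rewrite -sum1_card; apply: leq_sum => v _; apply: dpos. Qed.

Lemma card_E_le : #|E| <= kappa E.
Proof.
rewrite kappaE -sum1_card; apply: leq_sum => e eE; rewrite card_gt0.
by apply: contraNneq E0 => <-.
Qed.

Lemma kappa_le : kappa E <= #|E| * rank E.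
Proof.
rewrite kappaE -sum_nat_const; apply: leq_sum => e eE.
exact: (leq_bigmax_cond (F := fun e : {set V} => #|e|)).
Qed.

Lemma max_deg_le : max_deg E <= kappa E.
Proof. by apply/bigmax_leqP => v _; rewrite /kappa (bigD1 v) //= leq_addr. Qed.

Lemma rank_le : rank E <= kappa E.
Proof. by apply/bigmax_leqP => e eE; rewrite kappaE (bigD1 e) //= leq_addr. Qed.

Lemma csr_vrows : csr #|V| (kappa E) (nth 0 (offsets vrows)) (nth 0 (flatten vrows)) inc.
Proof.
rewrite -size_vrows -size_flatten_vrows; apply: csr_rows => [i|i j].
  by rewrite size_vrows => /vrow_bounds /andP[].
exact: mem_vrow.
Qed.

Lemma csr_erows : csr #|E| (kappa E) (nth 0 (offsets erows)) (nth 0 (flatten erows))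
  (fun j i => inc i j).
Proof.
rewrite -size_erows -size_flatten_erows; apply: csr_rows => [i|i j].
  by rewrite size_erows => /erow_bounds /andP[].
exact: mem_erow.
Qed.

Lemma vrow_len i : i < #|V| ->
  nth 0 (offsets vrows) i.+1 - nth 0 (offsets vrows) i <= maxn (max_deg E) (rank E).
Proof.
move=> ni; rewrite offsetsS ?size_vrows // addKn leq_max.
by case/andP: (vrow_bounds ni) => _ ->.
Qed.

Lemma erow_len j : j < #|E| ->
  nth 0 (offsets erows) j.+1 - nth 0 (offsets erows) j <= maxn (max_deg E) (rank E).
Proof.
move=> jm; rewrite offsetsS ?size_erows // addKn leq_max.
by case/andP: (erow_bounds jm) => _ ->; rewrite orbT.
Qed.

Section Run.
Variables (R : realType) (rnd : nat -> nat -> R) (B : nat).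
Hypothesis En0 : E != finset.set0.
Let w (r : nat) (e : {set V}) : R := rnd r (index e es).
Let l := lg #|E|.
Let X := lg (max_deg E) + lg (rank E).
Let phase := Seq rounds_prog check_prog.

(** In the time, 7 is 4 + 3: [Lb.+1] and [l.+1] are at most [2 * X] and [2 * l], and [h.+1] is at
    most [3 * (X * l)]. In the work, [6 * N] is at most [12 * kappa E], and [l.+1] doubles this to
    24. Each 3 is the price of a test of the loop guard. *)
Lemma runs_lm_prog : 0 < B ->
  (forall r, r < B * l -> {in [pred k | k < #|E|] &, injective (rnd r)}) ->
  act_edges (lm_run E w (B * l)) = finset.set0 ->
  runs rnd lm_prog (input_state R E vrows erows)
    ((3 * cmd_size prep_prog + 3 + B * (3 + 7 * cmd_size phase)) * (X * l))
    ((12 * cmd_size prep_prog + 3 + B * (3 + 24 * cmd_size phase)) * (kappa E * l))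
    (fun s => exists r, act_edges (lm_run E w r) = finset.set0 /\
       forall e, e \in E -> ints s aOut (index e es) = (e \in matched (lm_run E w r))).
Proof.
move=> B0 inj aK; set s0 := input_state _ _ _ _.
have m0 : 0 < #|E| by rewrite card_gt0.
have k0 : 0 < kappa E by apply: leq_trans m0 card_E_le.
have lk : maxn (max_deg E) (rank E) <= kappa E by rewrite geq_max max_deg_le rank_le.
have incb i j : inc i j -> (i < #|V|) && (j < #|E|) by move=> hi; apply: (incidence_lt repPvs hi).
have z0 a x : 4 < a -> ints s0 a x = 0.
  by do 5?[case: a => // a] => _; rewrite /s0 /= /input_ints /= nth_nil nth_nil.
set h := up_log 2 (kappa E).
have hp := @runs_prep R rnd s0 inc (maxn (max_deg E) (rank E)) k0 card_V_le card_E_le lk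
  csr_vrows csr_erows incb vrow_len erow_len z0.
set N := 2 ^ h.
have lgm : #|E| < 2 ^ l by rewrite trunc_log_ltn.
have l0 : 0 < l by [].
have X2 : 1 < X by rewrite /X /lg; lia.
(* This makes scans of full height affordable: kappa is at most m d, so its logarithm is bounded by
   those of m and d. *)
have hl : h <= l + lg (rank E).
  apply: up_log_min => //; apply: leq_trans kappa_le _; rewrite expnD.
  by apply: leq_mul; rewrite ltnW // trunc_log_ltn.
have hX : h.+1 <= 3 * (X * l).
  have : lg (rank E) <= X by rewrite leq_addl.
  have : 0 < lg (rank E) by [].
  by nia.
have N2 : N <= 2 * kappa E.
  rewrite /N /h; case: (ltngtP (kappa E) 1) k0 => // [k1 _|-> _]; last by [].
  have /andP[hb _] := up_log_bounds (isT : 1 < 2) k1.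
  have : 0 < up_log 2 (kappa E) by rewrite up_log_gt0.
  by case: (up_log _ _) hb => // u /=; rewrite expnS => ? _; lia.
pose Lb := lg (maxn (max_deg E) (rank E)).
have LbX : Lb <= X.
  rewrite /Lb /X; by case: (leqP (max_deg E) (rank E)) => _; rewrite ?leq_addl ?leq_addr.
pose tph := cmd_size phase * (Lb.+1 * l.+1 + h.+1).
pose wph := cmd_size phase * (6 * N * l.+1).
have hr : runs rnd lm_prog s0 (cmd_size prep_prog * h.+1 + (3 + B * (3 + tph)))
   (cmd_size prep_prog * (6 * N) + (3 + B * (3 + wph)))
    (fun s => exists r, act_edges (lm_run E w r) = finset.set0 /\
       forall e, e \in E -> ints s aOut (index e es) = (e \in matched (lm_run E w r))).
  apply: (runs_seq (hp : runs rnd prep_prog s0 _ _ _)) => s [L [LL P dr ac [nw ou fl in0]]].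
  have bn : ints s 0 0 = #|V| by rewrite in0.
  have bm : ints s 0 1 = #|E| by rewrite in0.
  have ri : round_inv rnd E es (ints s) 0 s.
    split=> //.
    - by move=> j; rewrite ac /=; case: ltnP => //= jm; rewrite (nthe_in repPes jm).
    - by move=> j jm; rewrite ou inE.
  have hf : (ints s rFlag 0 = 0 /\ act_edges (lm_run E w 0) = finset.set0) \/
     (ints s rFlag 0 != 0 /\ 0 < B) by right; rewrite fl.
  have := runs_phases repPvs repPes E0 P bn bm m0 inj aK (add0n _) ri hf.
  move=> hr; apply: (runs_weaken hr).
  - rewrite leq_add2l leq_mul2l leq_add2l leq_mul2l leq_add2r leq_mul2r ltnS LL.
    by rewrite !orbT.
  - by [].
  move=> s' [r [a0 [_ _ _ _ om]]]; exists r; split=> // e eE.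
  by rewrite om ?(index_es repPes) // (nthe_index repPes).
apply: (runs_weaken hr) => //.
- have h1 : tph <= cmd_size phase * (7 * (X * l)).
    by rewrite leq_mul2l; apply/orP; right; nia.
  have h2 : cmd_size prep_prog * h.+1 <= cmd_size prep_prog * (3 * (X * l)) by rewrite leq_mul2l hX orbT.
  have h3 : 1 <= X * l by nia.
  clearbody tph; move: (cmd_size prep_prog) (cmd_size phase) h1 h2 => cp cph h1 h2.
  have h4 : B * (3 + tph) <= B * ((3 + 7 * cph) * (X * l)).
    by rewrite leq_mul2l; apply/orP; right; nia.
  have -> : (3 * cp + 3 + B * (3 + 7 * cph)) * (X * l) =
     cp * (3 * (X * l)) + (3 * (X * l) + B * ((3 + 7 * cph) * (X * l))) by ring.
  by apply: leq_add => //; apply: leq_add => //; lia.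
- have kl : 1 <= kappa E * l by nia.
  have Nl : 6 * N <= 12 * (kappa E * l) by nia.
  have h1 : wph <= cmd_size phase * (24 * (kappa E * l)).
    by rewrite leq_mul2l; apply/orP; right; nia.
  have h2 : cmd_size prep_prog * (6 * N) <= cmd_size prep_prog * (12 * (kappa E * l)) by rewrite leq_mul2l Nl orbT.
  clearbody wph; move: (cmd_size prep_prog) (cmd_size phase) h1 h2 => cp cph h1 h2.
  have h4 : B * (3 + wph) <= B * ((3 + 24 * cph) * (kappa E * l)).
    by rewrite leq_mul2l; apply/orP; right; nia.
  have -> : (12 * cp + 3 + B * (3 + 24 * cph)) * (kappa E * l) =
     cp * (12 * (kappa E * l)) + (3 * (kappa E * l) + B * ((3 + 24 * cph) * (kappa E * l))) by ring.
  by apply: leq_add => //; apply: leq_add => //; lia.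
Qed.
End Run.
End Represents.

(** * Good outcomes and the final bounds *)

Local Open Scope classical_set_scope.
Local Open Scope ring_scope.

Section Numbering.
Variables (V : finType) (E : {set {set V}}) (es : seq {set V}).
Hypothesis Pes : perm_eq es (enum E).

(* Extends [es] to all subsets of [V], so that weight functions can be defined on the whole
   finite type. *)
Definition numbering (e : {set V}) : nat := index e (es ++ enum (~: E)).

Lemma numbering_inj : injective numbering.
Proof.
have me e : e \in es ++ enum (~: E).
  by rewrite mem_cat (mem_es Pes) mem_enum inE orbN.
by move=> e e' h; rewrite -(nth_index e (me e)) -[RHS](nth_index e (me e')) -/(numbering e) h.
Qed.

Lemma numberingE e : e \in E -> numbering e = index e es.
Proof. by move=> eE; rewrite /numbering index_cat (mem_es Pes) eE. Qed.
End Numbering.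

Lemma slot_le (R : realType) N' k l (y z : R) : slot N' k y -> slot N' l z ->
  (k < l)%N -> y < z.
Proof.
rewrite /slot /= !in_itv /= => /andP[_ h1] /andP[h2 _] kl.
apply: lt_le_trans h1 (le_trans _ h2).
by rewrite ler_pM2r ?invr_gt0 ?ltr0n // ler_nat.
Qed.

Section GoodWeights.
Variables (V : finType) (E : {set {set V}}) (es : seq {set V}).
Hypothesis Pes : perm_eq es (enum E).
Variables (R : realType) (N' K : nat) (rnd : nat -> nat -> R).
Variable t : K.-tuple {ffun {set V} -> 'I_N'.+1}.
Hypothesis slots : forall r e, (r < K)%N ->
  slot N' (nth [ffun=> ord0] t r e) (rnd r (numbering E es e)).
Hypothesis good : t \notin failing R E N'.+1 K.
Let f r := nth [ffun=> ord0] t r.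

Lemma good_inj r : (r < K)%N -> injective (f r).
Proof.
move=> rK; move: good; rewrite inE negbK => /andP[/allP h _].
have : f r \in (t : seq _) by rewrite mem_nth // size_tuple.
by move/h; rewrite /= inE => /injectiveP.
Qed.

Lemma good_rnd_inj r : (r < K)%N -> {in [pred k | (k < #|E|)%N] &, injective (rnd r)}.
Proof.
move=> rK i j; rewrite !inE => im jm eq.
rewrite -(index_nthe Pes im) -(index_nthe Pes jm); congr (index _ es).
apply: (good_inj rK); apply/val_inj.
have si := slots (nthe es i) rK; have sj := slots (nthe es j) rK.
rewrite !(numberingE Pes) ?(nthe_in Pes) // !(index_nthe Pes) // eq in si sj.
exact: slot_inj si sj.
Qed.

(** Without ties distinct hyperedges have weights in distinct slots, so the real weights compare
    exactly as the slot numbers do. *)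
Lemma good_run : act_edges (lm_run E (fun r e => rnd r (index e es)) K) = finset.set0.
Proof.
have -> : lm_run E (fun r e => rnd r (index e es)) K = lm_run E (fun r => wt R (f r)) K.
  apply: eq_lm_run => r e e' rK eE e'E.
  have := slots e rK; have := slots e' rK; rewrite !(numberingE Pes) // -/(f r) => s' s.
  rewrite /wt ler_nat; case: (ltngtP (f r e) (f r e')) => h.
  - by rewrite ltW // (slot_le s s').
  - by apply/negbTE; rewrite -ltNge (slot_le s' s).
  - by rewrite (good_inj rK (val_inj h)) lexx.
rewrite lm_run_runs ?size_tuple // take_oversize ?size_tuple //.
by move: good; rewrite inE negbK => /andP[_ /eqP].
Qed.
End GoodWeights.

Theorem theorem2 :
  exists prog : cmd, forall c : nat, exists C : nat,
  forall (V : finType) (E : {set {set V}}),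
    E != finset.set0 -> finset.set0 \notin E ->
    (forall v : V, (0 < deg E v)%N) ->
  forall (vs : seq V) (es : seq {set V}) (vrows erows : seq (seq nat)),
    represents E vs es vrows erows ->
  forall (R : realType) (dsp : measure_display) (T : measurableType dsp)
    (P : probability T R) (U : nat * nat -> {RV P >-> R}),
    mutually_independent U -> (forall i, uniform01 (U i)) ->
  exists A : set T,
    [/\ measurable A,
        ((1 - (#|E|.+1%:R ^+ c)^-1)%:E <= P A)%E
      & forall x : T, A x ->
        exists (s : pram_state R) (t w : nat) (M : {set {set V}}),
          [/\ exec (fun k j => U (k, j) x) prog
                (input_state R E vrows erows) s t w,
              (t <= C * ((lg (max_deg E) + lg (rank E)) * lg #|E|))%N,
              (w <= C * ((kappa E + #|V|) * lg #|E|))%N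
            & [/\ outputs E es s M,
                  lm_output E (fun r e => U (r, index e es) x) M
                & is_maximal_matching E M]]].
Proof.
exists lm_prog => c.
pose phase := Seq rounds_prog check_prog; pose B := (c + 3)%N.
pose C1 := (3 * cmd_size prep_prog + 3 + B * (3 + 7 * cmd_size phase))%N.
pose C2 := (12 * cmd_size prep_prog + 3 + B * (3 + 24 * cmd_size phase))%N.
exists (C1 + C2)%N => V E En0 E0 dpos vs es vrows erows Rep R dsp T P U indU unifU.
have Pes := repPes Rep.
pose K := (B * lg #|E|)%N; pose s := #|{: {set V}}|; pose M := (#|E|.+1 ^ c)%N.
(* The union bound for ties is over [K] rounds and [s * s] pairs of sets; the remaining factor
   [2 * M] brings it down to half of the allowed failure probability. *)
pose N' := (2 * (K * (s * s)) * M)%N.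
have K0 : (0 < K)%N by rewrite muln_gt0 addn_gt0 orbT.
(* The origin of [c + 3]: the initial potential, at most m^2, and the factor 2 for the two kinds of
   failure cost no more than three factors m + 1, and [M] costs [c] more. *)
have hK : (2 * (#|E| * #|E|) * M <= 2 ^ K)%N.
  have lgm : (#|E|.+1 <= 2 ^ lg #|E|)%N by rewrite trunc_log_ltn.
  rewrite /K (mulnC B) expnM; apply: (@leq_trans (#|E|.+1 ^ B)%N).
    rewrite /B expnD -/M [X in (X <= _)%N]mulnC leq_mul2l; apply/orP; right.
    by rewrite !expnS expn0; nia.
  by rewrite leq_exp2r // addn_gt0 orbT.
pose G := finset.setC (failing R E N'.+1 K).
pose num := numbering E es.
have numI : injective num by exact: numbering_inj.
have [mA PA] := prob_cells indU unifU numI G.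
set A := \bigcup_(t in _) _ in mA PA.
exists A; split=> //.
- rewrite PA lee_fin.
  set O := (_ ^+ (K * s) : R).
  have O0 : 0 < O by rewrite exprn_gt0 // ltr0n.
  have cT : (#|{: K.-tuple {ffun {set V} -> 'I_N'.+1}}|%:R : R) = O.
    by rewrite card_tuple card_ffun card_ord -expnM mulnC natrX.
  have hb := @card_failing R V E N'.+1 E0 K M K0 En0 (leqnSn _) hK.
  rewrite -card_tuple -(ler_nat R) cT natrM in hb.
  have cG : (#|G|%:R : R) = O - #|failing R E N'.+1 K|%:R.
    have hc : (#|failing R E N'.+1 K| + #|G|)%N = #|{: K.-tuple {ffun {set V} -> 'I_N'.+1}}| := cardsC _.
    by rewrite -cT -hc natrD addrAC subrr add0r.
  have M0 : 0 < (M%:R : R) by rewrite ltr0n expn_gt0.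
  rewrite cG mulrBl divff ?gt_eqF // lerD2l lerN2 -natrX -/M.
  by rewrite ler_pdivrMr // mulrC ler_pdivlMr // mulrC.
move=> x [t]; rewrite /= mem_enum inE => tG ct.
pose rnd k j := U (k, j) x.
have slots r e : (r < K)%N -> slot N' (nth [ffun=> ord0] t r e) (rnd r (num e)).
  by move=> rK; apply: (cellP numI).
have inj := good_rnd_inj Pes slots tG.
have aK := good_run Pes slots tG.
have B0 : (0 < B)%N by rewrite addn_gt0 orbT.
have [s' [t' [w' [ex ht hw [r [a0 out]]]]]] := runs_lm_prog E0 dpos Rep En0 B0 inj aK.
exists s', t', w', (matched (lm_run E (fun r e => U (r, index e es) x) r)); split=> //.
- by apply: leq_trans ht _; rewrite leq_mul2r leq_addr orbT.
- apply: leq_trans hw _; apply: leq_mul; first exact: leq_addl.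
  by rewrite leq_mul2r leq_addr orbT.
split=> //; first by exists r.
exact: lm_maximal.
Qed.
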